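(* Let $(r,\Lambda,A)$ be an admissible triple with $\Lambda\neq\{1\}$, and let $G$ be a subgroup of $\mathrm{V}(r,\mathbb R^*_+,\mathbb R)$ with $G\cap\mathrm{F}(r,\mathbb R^*_+,\mathbb R)=\mathrm{F}(r,\Lambda,A)$. Then the elementary theory of the group $G$ is hereditarily undecidable. (In particular this holds for $G=\mathrm{F}(r,\Lambda,A)$, $\mathrm{T}(r,\Lambda,A)$, $\mathrm{V}(r,\Lambda,A)$.)
   Context: An admissible triple $(r,\Lambda,A)$: $r>0$ real, $\Lambda\le\mathbb R^*_+$ a multiplicative subgroup, $A\subseteq\mathbb R$ an additive subgroup with $r\in A$ and $\Lambda A\subseteq A$. $\mathrm{V}(r,\Lambda,A)$ is the group of bijections $x\colon[0,r)\to[0,r)$ that are piecewise affine with finitely many cuts and singular points, right-continuous everywhere, with all slopes in $\Lambda$ and all cut/singular points and their images in $A$ (maps act on the right). $\mathrm{F}(r,\Lambda,A)$ is its subgroup of elements continuous in the usual topology; $\mathrm{T}(r,\Lambda,A)$ its subgroup of elements continuous in the circle topology of $[0,r)\cong[0,r]/\{0,r\}$. A theory $T$ of finite signature $\Sigma$ is hereditarily undecidable if every $\Sigma$-theory contained in $T$ (a consistent set of $\Sigma$-sentences closed under consequence) is undecidable. *)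

(* Defs.v *)
From Stdlib Require Import Reals List Arith ClassicalEpsilon.
Import ListNotations.
Open Scope R_scope.

Inductive rfun : Type :=
| RZero : rfun
| RSucc : rfun
| RProj : nat -> rfun
| RComp : rfun -> list rfun -> rfun
| RPrec : rfun -> rfun -> rfun
| RMu   : rfun -> rfun.

Inductive reval : rfun -> list nat -> nat -> Prop :=
| ev_zero xs : reval RZero xs 0
| ev_succ xs : reval RSucc xs (S (hd 0%nat xs))
| ev_proj i xs : reval (RProj i) xs (nth i xs 0%nat)
| ev_comp f gs xs ys y :
    Forall2 (fun g y => reval g xs y) gs ys -> reval f ys y ->
    reval (RComp f gs) xs y
| ev_prec0 f g xs y : reval f xs y -> reval (RPrec f g) (0%nat :: xs) y
| ev_precS f g n xs z y :
    reval (RPrec f g) (n :: xs) z -> reval g (n :: z :: xs) y ->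
    reval (RPrec f g) (S n :: xs) y
| ev_mu f xs n :
    reval f (n :: xs) 0 ->
    (forall m, (m < n)%nat -> exists k, reval f (m :: xs) (S k)) ->
    reval (RMu f) xs n.

Definition decidable_nat_set (P : nat -> Prop) : Prop :=
  exists f : rfun, forall n,
    (P n /\ reval f [n] 1%nat) \/ (~ P n /\ reval f [n] 0%nat).

Inductive term : Type :=
| tvar : nat -> term
| tone : term
| tinv : term -> term
| tmul : term -> term -> term.

Inductive form : Type :=
| ffal : form
| feq  : term -> term -> form
| fneg : form -> form
| fand : form -> form -> form
| for_ : form -> form -> form
| fimp : form -> form -> form
| fall : form -> form
| fex  : form -> form.

Definition scons {M : Type} (x : M) (env : nat -> M) : nat -> M :=
  fun n => match n with O => x | S k => env k end.

Fixpoint teval {M : Type} (mul : M -> M -> M) (inv : M -> M) (one : M)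
  (env : nat -> M) (t : term) : M :=
  match t with
  | tvar n => env n
  | tone => one
  | tinv u => inv (teval mul inv one env u)
  | tmul u v => mul (teval mul inv one env u) (teval mul inv one env v)
  end.

Fixpoint sat {M : Type} (dom : M -> Prop) (mul : M -> M -> M) (inv : M -> M)
  (one : M) (env : nat -> M) (p : form) : Prop :=
  match p with
  | ffal => False
  | feq t u => teval mul inv one env t = teval mul inv one env u
  | fneg q => ~ sat dom mul inv one env q
  | fand q s => sat dom mul inv one env q /\ sat dom mul inv one env s
  | for_ q s => sat dom mul inv one env q \/ sat dom mul inv one env s
  | fimp q s => sat dom mul inv one env q -> sat dom mul inv one env s
  | fall q => forall x, dom x -> sat dom mul inv one (scons x env) q
  | fex q => exists x, dom x /\ sat dom mul inv one (scons x env) q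
  end.

Fixpoint term_closed (k : nat) (t : term) : bool :=
  match t with
  | tvar n => Nat.ltb n k
  | tone => true
  | tinv u => term_closed k u
  | tmul u v => term_closed k u && term_closed k v
  end.

Fixpoint form_closed (k : nat) (p : form) : bool :=
  match p with
  | ffal => true
  | feq t u => term_closed k t && term_closed k u
  | fneg q => form_closed k q
  | fand q s | for_ q s | fimp q s => form_closed k q && form_closed k s
  | fall q | fex q => form_closed (S k) q
  end.

Definition sentence (p : form) : Prop := form_closed 0 p = true.

Definition consequence (T : form -> Prop) (p : form) : Prop :=
  forall (M : Type) (mul : M -> M -> M) (inv : M -> M) (one : M),
    (forall q, T q -> forall env, sat (fun _ => True) mul inv one env q) ->
    forall env, sat (fun _ => True) mul inv one env p.

Definition cpair (x y : nat) : nat := ((x + y) * (x + y + 1)) / 2 + y.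

Fixpoint code_term (t : term) : nat :=
  match t with
  | tvar n => cpair 0 n
  | tone => cpair 1 0
  | tinv u => cpair 2 (code_term u)
  | tmul u v => cpair 3 (cpair (code_term u) (code_term v))
  end.

Fixpoint code_form (p : form) : nat :=
  match p with
  | ffal => cpair 0 0
  | feq t u => cpair 1 (cpair (code_term t) (code_term u))
  | fneg q => cpair 2 (code_form q)
  | fand q s => cpair 3 (cpair (code_form q) (code_form s))
  | for_ q s => cpair 4 (cpair (code_form q) (code_form s))
  | fimp q s => cpair 5 (cpair (code_form q) (code_form s))
  | fall q => cpair 6 (code_form q)
  | fex q => cpair 7 (code_form q)
  end.

Definition decidable_theory (T : form -> Prop) : Prop :=
  decidable_nat_set (fun n => exists p, T p /\ code_form p = n).

(* A theory Th (set of sentences) is hereditarily undecidable if every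
   theory contained in it (set of sentences closed under consequence;
   consistency is automatic since it lies inside Th) is undecidable. *)
Definition hereditarily_undecidable (Th : form -> Prop) : Prop :=
  forall T : form -> Prop,
    (forall p, T p -> sentence p /\ Th p) ->
    (forall p, sentence p -> consequence T p -> T p) ->
    ~ decidable_theory T.

(* Thompson-like groups.  An element of V(r,Lam,A) (a bijection of      *)
(* [0,r)) is represented as a map R -> R which is the identity outside  *)
(* [0,r).                                                               *)
Definition admissible (r : R) (Lam A : R -> Prop) : Prop :=
  0 < r /\
  (forall l, Lam l -> 0 < l) /\ Lam 1 /\
  (forall l m, Lam l -> Lam m -> Lam (l * m)) /\
  (forall l, Lam l -> Lam (/ l)) /\
  A 0 /\ (forall a b, A a -> A b -> A (a + b)) /\ (forall a, A a -> A (- a)) /\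
  A r /\ (forall l a, Lam l -> A a -> A (l * a)).

Definition in_r (r t : R) : Prop := 0 <= t < r.

Definition bij_r (r : R) (x : R -> R) : Prop :=
  (forall t, in_r r t -> in_r r (x t)) /\
  (forall s, in_r r s -> exists t, in_r r t /\ x t = s) /\
  (forall t u, in_r r t -> in_r r u -> x t = x u -> t = u) /\
  (forall t, ~ in_r r t -> x t = t).

(* Piecewise affine, right-continuous, finitely many breakpoints
   0 = a_0 < ... < a_n = r (containing all cut and singular points),
   breakpoints and their images in A, slopes in Lam. *)
Definition pw_affine (r : R) (Lam A : R -> Prop) (x : R -> R) : Prop :=
  exists (n : nat) (a lam b : nat -> R),
    a 0%nat = 0 /\ a n = r /\
    (forall i, (i < n)%nat -> a i < a (S i)) /\
    (forall i, (i <= n)%nat -> A (a i)) /\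
    (forall i, (i < n)%nat ->
       Lam (lam i) /\ A (x (a i)) /\
       (forall t, a i <= t < a (S i) -> x t = lam i * t + b i)).

Definition inV (r : R) (Lam A : R -> Prop) (x : R -> R) : Prop :=
  bij_r r x /\ pw_affine r Lam A x.

Definition cont_r (r : R) (x : R -> R) : Prop :=
  forall t, in_r r t -> forall eps, 0 < eps -> exists delta, 0 < delta /\
    forall s, in_r r s -> Rabs (s - t) < delta -> Rabs (x s - x t) < eps.

Definition inF (r : R) (Lam A : R -> Prop) (x : R -> R) : Prop :=
  inV r Lam A x /\ cont_r r x.

Definition posR : R -> Prop := fun l => 0 < l.
Definition allR : R -> Prop := fun _ => True.

(* Group operations (maps act on the right: x*y = first x, then y). *)
Definition gmul (f g : R -> R) : R -> R := fun t => g (f t).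
Definition gone : R -> R := fun t => t.
Definition ginv (f : R -> R) : R -> R :=
  fun y => epsilon (inhabits 0) (fun t => f t = y).

Definition is_subgroup_of_V (r : R) (G : (R -> R) -> Prop) : Prop :=
  (forall x, G x -> inV r posR allR x) /\
  G gone /\
  (forall x y, G x -> G y -> G (gmul x y)) /\
  (forall x, G x -> G (ginv x)).

Definition elem_theory (G : (R -> R) -> Prop) (p : form) : Prop :=
  sentence p /\ sat G gmul ginv gone (fun _ => gone) p.

(* Main.v *)
(* The theorem reduces to interpreting, with three distinguished elements [x],
   [z], [p], a weak theory of finite binary relations on numbers: zero, an
   injective successor omitting zero, an empty relation, and the insertion of
   one pair into a relation. This theory has finitely many axioms, and all
   recursive functions are representable in each of its models, since a finite
   relation can record a computation by recursion or by search; a Goedel sentence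
   then refutes every decision procedure.

   In the group, [x] moves an interval [(a, b)] upwards, and [z] squeezes [(a, b)]
   into a fundamental domain of [x]. The number [n] is the conjugate of [w = x^z]
   by [x^n]; the conjugates of [w] by [x^m z x^n], for all [m] and [n], have
   disjoint supports, and an arbitrary group element encodes the relation formed
   by the pairs [(n, m)] whose conjugate it does not commute with. A pair is
   inserted by multiplying with an element supported in a single one of these
   supports. The numbers are definable because every element that commutes with
   [x] coincides with a power of [x] on a fundamental domain: it is a scaling near
   [a] and near [b], and the two scalings are trivial up to a power of [x] since
   [x] breaks only once per fundamental domain. Finally, [p] separates the
   nonnegative powers of [x] from the negative ones. *)
Require Import Defs.
From Stdlib Require Import Reals.
From Stdlib Require Import List Arith Lia Lra Psatz Cantor.
From Stdlib Require Import Classical ClassicalEpsilon FunctionalExtensionality.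
Import ListNotations.
Open Scope R_scope.

Local Open Scope nat_scope.

(** * Codes of formulas and recursive functions *)

(** A product of two consecutive numbers is even, so the truncating division is exact and
    injectivity can be taken from the Cantor pairing. *)
Lemma cpair_cantor x y : cpair x y = Cantor.to_nat (x, y).
Proof.
  unfold cpair. pose proof (Cantor.to_nat_spec x y) as H.
  replace ((x + y) * (x + y + 1)) with ((Cantor.to_nat (x, y) - y) * 2).
  - rewrite Nat.div_mul by discriminate.
    pose proof (Cantor.to_nat_non_decreasing x y). lia.
  - rewrite Nat.mul_sub_distr_r, H. rewrite (Nat.add_comm y x). lia.
Qed.

Lemma cpair_inj x y x' y' : cpair x y = cpair x' y' -> x = x' /\ y = y'.
Proof.
  rewrite !cpair_cantor. intros H%Cantor.to_nat_inj. split; congruence.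
Qed.

Lemma code_term_inj t : forall u, code_term t = code_term u -> t = u.
Proof.
  induction t; intros [] H; cbn [code_term] in H;
    apply cpair_inj in H as [H1 H2]; try discriminate; auto;
    try (apply cpair_inj in H2 as [? ?]); f_equal; auto.
Qed.

Lemma code_form_inj p : forall q, code_form p = code_form q -> p = q.
Proof.
  induction p; intros [] H; cbn [code_form] in H;
    apply cpair_inj in H as [H1 H2]; try discriminate; auto;
    try (apply cpair_inj in H2 as [? ?]); f_equal; auto using code_term_inj.
Qed.

Fixpoint rconst (n : nat) : rfun :=
  match n with
  | 0 => RZero
  | S n => RComp RSucc [rconst n]
  end.

Lemma reval_comp1 f g xs a b :
  reval g xs a -> reval f [a] b -> reval (RComp f [g]) xs b.
Proof. intros. apply ev_comp with [a]; auto. Qed.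

Lemma reval_comp2 f g h xs a b c :
  reval g xs a -> reval h xs b -> reval f [a; b] c ->
  reval (RComp f [g; h]) xs c.
Proof. intros. apply ev_comp with [a; b]; auto. Qed.

Lemma reval_const n xs : reval (rconst n) xs n.
Proof.
  induction n; cbn; [constructor|].
  eapply reval_comp1; [eassumption|]. apply (ev_succ [n]).
Qed.

Definition radd : rfun := RPrec (RProj 0) (RComp RSucc [RProj 1]).

Lemma reval_add m n : reval radd [m; n] (m + n).
Proof.
  induction m as [|m IH]; cbn.
  - apply ev_prec0. apply (ev_proj 0 [n]).
  - eapply ev_precS; [exact IH|]. eapply reval_comp1.
    + apply (ev_proj 1 [m; m + n; n]).
    + apply (ev_succ [m + n]).
Qed.

(** Triangular numbers, in the recursion pattern of [Cantor.to_nat], so that [reval_cpair] needs no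
    arithmetic. *)
Definition rtri : rfun :=
  RPrec RZero (RComp radd [RComp RSucc [RProj 0]; RProj 1]).

Lemma reval_tri n :
  reval rtri [n] (nat_rec _ 0 (fun i m => S i + m) n).
Proof.
  induction n as [|n IH].
  - apply ev_prec0, ev_zero.
  - eapply ev_precS; [exact IH|].
    eapply reval_comp2; [|apply (ev_proj 1)|apply reval_add].
    eapply reval_comp1; [apply (ev_proj 0)|apply ev_succ].
Qed.

Definition rcpair : rfun :=
  RComp radd [RProj 1; RComp rtri [RComp radd [RProj 1; RProj 0]]].

Lemma reval_cpair x y : reval rcpair [x; y] (cpair x y).
Proof.
  rewrite cpair_cantor. eapply reval_comp2; [apply (ev_proj 1)| |apply reval_add].
  eapply reval_comp1; [|apply reval_tri].
  eapply reval_comp2; [apply (ev_proj 1)|apply (ev_proj 0)|apply reval_add].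
Qed.

(** The generated principle gives no hypothesis for the functions in the list argument of
    [RComp]. *)
Lemma rfun_nested_ind (P : rfun -> Prop) :
  P RZero -> P RSucc -> (forall i, P (RProj i)) ->
  (forall f gs, P f -> Forall P gs -> P (RComp f gs)) ->
  (forall f g, P f -> P g -> P (RPrec f g)) ->
  (forall f, P f -> P (RMu f)) ->
  forall f, P f.
Proof.
  intros H0 HS Hp Hc Hr Hm. fix IH 1. intros [| |i|f gs|f g|f].
  - exact H0.
  - exact HS.
  - apply Hp.
  - apply Hc; [apply IH|]. induction gs; constructor; [apply IH|assumption].
  - apply Hr; apply IH.
  - apply Hm, IH.
Qed.

(** * The arithmetic of a group with three distinguished elements *)

Definition tconj (a b : term) : term := tmul (tinv b) (tmul a b).
Definition tzero (k : nat) : term := tconj (tvar k) (tvar (S k)).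
Definition tsucc (k : nat) (t : term) : term := tconj t (tvar k).
Definition fcomm (t u : term) : form := feq (tmul t u) (tmul u t).

(* In all the formulas below, the distinguished elements [x], [z], [p] are the
   values of the variables [k], [k + 1], [k + 2]; numbers, sets and lists of
   numbers are passed as variable indices. *)
Definition fnum (k y : nat) : form :=
  fex (fand (fcomm (tvar 0) (tvar (S k)))
      (fand (feq (tvar (S y)) (tconj (tzero (S k)) (tvar 0)))
            (fneg (fcomm (tvar (S (S (S k)))) (tvar (S y)))))).

(** The witness carries zero to [i]; the same witness carries the squeezed copy of [j] to the
    element that is tested against [g]. *)
Definition frel (k g i j : nat) : form :=
  fex (fand (fcomm (tvar 0) (tvar (S k)))
      (fand (feq (tvar (S i)) (tconj (tzero (S k)) (tvar 0)))
            (fneg (fcomm (tvar (S g))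
              (tconj (tconj (tvar (S j)) (tvar (S (S k)))) (tvar 0)))))).

Definition fexN (k : nat) (q : form) : form := fex (fand (fnum (S k) 0) q).
Definition fallN (k : nat) (q : form) : form := fall (fimp (fnum (S k) 0) q).

(** [fnum] accepts only variables, so zero and successors are first named by an equation; the last
    axiom spells out an equivalence as two implications. *)
Definition fax : form :=
  fand (fall (fimp (feq (tvar 0) (tzero 1)) (fnum 1 0)))
  (fand (fall (fall (fimp (fnum 2 1)
    (fimp (feq (tvar 0) (tsucc 2 (tvar 1))) (fnum 2 0)))))
  (fand (fallN 0 (fallN 1
    (fimp (feq (tsucc 2 (tvar 1)) (tsucc 2 (tvar 0))) (feq (tvar 1) (tvar 0)))))
  (fand (fallN 0 (fneg (feq (tsucc 1 (tvar 0)) (tzero 1))))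
  (fand (fex (fallN 1 (fallN 2 (fneg (frel 3 2 1 0)))))
  (fall (fallN 1 (fallN 2 (fex (fallN 4 (fallN 5
    (fand (fimp (frel 6 2 1 0)
             (for_ (frel 6 5 1 0)
                (fand (feq (tvar 1) (tvar 4)) (feq (tvar 0) (tvar 3)))))
          (fimp (for_ (frel 6 5 1 0)
                  (fand (feq (tvar 1) (tvar 4)) (feq (tvar 0) (tvar 3))))
             (frel 6 2 1 0))))))))))))).

(** The values of the inner functions are bound one at a time, and [ys] collects their indices.
    Abstracting over [F] lets [frep] call itself on the members of a list. *)
Definition fcomp (F : rfun -> nat -> list nat -> nat -> form) (f : rfun) :=
  fix go (gs : list rfun) (k : nat) (xs ys : list nat) (y : nat) : form :=
    match gs with
    | [] => F f k ys y
    | g :: gs =>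
        fexN k (fand (F g (S k) (map S xs) 0)
                     (go gs (S k) (map S xs) (map S ys ++ [0]) (S y)))
    end.

(* A primitive recursion is witnessed by a set of pairs (index, value) each of
   which is either initial or justified by another one; an unbounded search, by
   a set that contains 0 and can only stop growing at the least zero. *)
Fixpoint frep (f : rfun) (k : nat) (xs : list nat) (y : nat) {struct f} : form :=
  match f with
  | RZero => feq (tvar y) (tzero k)
  | RSucc => feq (tvar y)
      (tsucc k (match xs with [] => tzero k | v :: _ => tvar v end))
  | RProj i => feq (tvar y) (nth i (map tvar xs) (tzero k))
  | RComp f gs => fcomp frep f gs k xs [] y
  | RPrec f g =>
      match xs with
      | [] => ffal
      | n :: xs =>
        fex (fand (frel (S k) 0 (S n) (S y))
          (fallN (1 + k) (fallN (2 + k) (fimp (frel (3 + k) 2 1 0)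
            (for_ (fand (feq (tvar 1) (tzero (3 + k)))
                        (frep f (3 + k) (map (Nat.add 3) xs) 0))
              (fexN (3 + k) (fexN (4 + k)
                (fand (feq (tvar 3) (tsucc (5 + k) (tvar 1)))
                (fand (frel (5 + k) 4 1 0)
                  (frep g (5 + k) (1 :: 0 :: map (Nat.add 5) xs) 2))))))))))
      end
  | RMu f =>
      fexN k (fand (feq (tvar 0) (tzero (S k)))
        (fand (frep f (S k) (S y :: map S xs) 0)
          (fex (fand (frel (2 + k) 0 1 1)
            (fallN (2 + k) (fimp (frel (3 + k) 1 0 2)
              (for_ (feq (tvar 0) (tvar (3 + y)))
                (fand (fneg (frep f (3 + k) (0 :: map (Nat.add 3) xs) 2))
                  (fexN (3 + k)
                    (fand (feq (tvar 0) (tsucc (4 + k) (tvar 1)))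
                          (frel (4 + k) 2 0 3)))))))))))
  end.


(** * Free variables of the formulas *)

Ltac closed_tac :=
  repeat match goal with
  | |- andb _ _ = true => apply andb_true_intro; split
  | |- Nat.ltb _ _ = true => apply Nat.ltb_lt; lia
  | |- true = true => reflexivity
  end.

Lemma fax_closed : form_closed 3 fax = true.
Proof. reflexivity. Qed.

Lemma fnum_closed c k y :
  2 + k < c -> y < c -> form_closed c (fnum k y) = true.
Proof. intros. cbn -[Nat.ltb]. closed_tac. Qed.

Lemma frel_closed c k g i j :
  2 + k < c -> g < c -> i < c -> j < c ->
  form_closed c (frel k g i j) = true.
Proof. intros. cbn -[Nat.ltb]. closed_tac. Qed.

Lemma shift_below m c xs :
  Forall (fun x => x < c) xs -> Forall (fun x => x < m + c) (map (Nat.add m) xs).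
Proof. rewrite Forall_map. apply Forall_impl. intros. lia. Qed.

Lemma frep_closed f : forall c k xs y,
  2 + k < c -> Forall (fun x => x < c) xs -> y < c ->
  form_closed c (frep f k xs y) = true.
Proof.
  induction f as [| |i|f gs IHf IHgs|f g IHf IHg|f IHf] using rfun_nested_ind;
    intros c k xs y Hk Hxs Hy.
  - cbn -[Nat.ltb]. closed_tac.
  - destruct Hxs; cbn -[Nat.ltb]; closed_tac.
  - cbn -[Nat.ltb nth]. apply andb_true_intro. split; [closed_tac|].
    revert i. induction Hxs; intros [|i]; cbn -[Nat.ltb]; closed_tac.
    apply IHHxs.
  - cbn [frep].
    assert (Hys : Forall (fun x => x < c) []) by constructor.
    revert Hys. generalize (@nil nat) as ys. revert c k xs y Hk Hxs Hy.
    induction IHgs as [|g gs IHg _ IH]; intros c k xs y Hk Hxs Hy ys Hys.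
    + cbn. auto.
    + cbn -[Nat.ltb fnum]. closed_tac.
      * apply fnum_closed; lia.
      * apply IHg; [lia|apply (shift_below 1); auto|lia].
      * apply IH; [lia|apply (shift_below 1); auto|lia|].
        apply Forall_app. split; [apply (shift_below 1); auto|].
        constructor; [lia|constructor].
  - destruct Hxs as [|n xs Hn Hxs]; [reflexivity|].
    cbn -[Nat.ltb fnum frel Nat.add]. closed_tac;
      try (apply fnum_closed; lia); try (apply frel_closed; lia).
    + apply IHf; [lia|apply (shift_below 3); auto|lia].
    + apply IHg; [lia| |lia].
      do 2 (constructor; [lia|]). apply (shift_below 5). auto.
  - cbn -[Nat.ltb fnum frel Nat.add]. closed_tac;
      try (apply fnum_closed; lia); try (apply frel_closed; lia).
    + apply IHf; [lia| |lia].
      constructor; [lia|]. apply (shift_below 1). auto.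
    + apply IHf; [lia| |lia].
      constructor; [lia|]. apply (shift_below 3). auto.
Qed.

Lemma reval_prec_inv f g n ns m :
  reval (RPrec f g) (n :: ns) m ->
  exists c : nat -> nat, c n = m /\ reval f ns (c 0) /\
    forall j, j < n -> reval g (j :: c j :: ns) (c (S j)).
Proof.
  revert m. induction n as [|n IH]; intros m H; inversion H; subst.
  - exists (fun _ => m). repeat split; auto. lia.
  - match goal with H' : reval (RPrec f g) (n :: ns) _ |- _ =>
      destruct (IH _ H') as (c & Hc & H0 & HS) end.
    exists (fun j => if j =? S n then m else c j). rewrite Nat.eqb_refl.
    repeat split; auto. intros j Hj.
    rewrite (proj2 (Nat.eqb_neq j (S n))) by lia.
    destruct (Nat.eqb_spec (S j) (S n)) as [E|E].
    + injection E as ->. now rewrite Hc.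
    + apply HS. lia.
Qed.

(** * Representability of recursive functions in the models of the axioms *)

Section Representability.
Variables (M : Type) (dom : M -> Prop) (mul : M -> M -> M) (inv : M -> M)
  (one : M) (x z p : M).

Definition commute (a b : M) : Prop := mul a b = mul b a.
Definition conjg (a b : M) : M := mul (inv b) (mul a b).

Definition is_num (y : M) : Prop :=
  exists h, dom h /\ commute h x /\ y = conjg (conjg x z) h /\ ~ commute p y.

Definition related (g i j : M) : Prop :=
  exists h, dom h /\ commute h x /\ i = conjg (conjg x z) h /\
    ~ commute g (conjg (conjg j z) h).

Fixpoint num (n : nat) : M :=
  match n with 0 => conjg x z | S n => conjg (num n) x end.

Notation sat := (sat dom mul inv one).

Definition params (k : nat) (env : nat -> M) : Prop :=
  env k = x /\ env (S k) = z /\ env (S (S k)) = p.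

Lemma sat_fnum k env y :
  params k env -> (sat env (fnum k y) <-> is_num (env y)).
Proof.
  intros (Ex & Ez & Ep). unfold is_num, commute, conjg. cbn.
  rewrite Ex, Ez, Ep. reflexivity.
Qed.

Lemma sat_frel k env g i j :
  params k env ->
  (sat env (frel k g i j) <-> related (env g) (env i) (env j)).
Proof.
  intros (Ex & Ez & Ep). unfold related, commute, conjg. cbn.
  rewrite Ex, Ez. reflexivity.
Qed.

Hypothesis dom_mul : forall a b, dom a -> dom b -> dom (mul a b).
Hypothesis dom_inv : forall a, dom a -> dom (inv a).
Hypothesis dom_x : dom x.
Hypothesis dom_z : dom z.

Lemma dom_conjg a b : dom a -> dom b -> dom (conjg a b).
Proof. unfold conjg. auto. Qed.

Lemma dom_is_num y : is_num y -> dom y.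
Proof. intros (h & Hh & _ & -> & _). auto using dom_conjg. Qed.

Lemma sat_fexN k env q Q :
  params k env -> (forall v, is_num v -> (sat (scons v env) q <-> Q v)) ->
  (sat env (fexN k q) <-> exists v, is_num v /\ Q v).
Proof.
  intros Hk HQ.
  assert (Hn : forall v, sat (scons v env) (fnum (S k) 0) <-> is_num v)
    by (intros v; apply (sat_fnum (S k) (scons v env)); exact Hk).
  split.
  - intros (v & _ & Hv & Hq). apply Hn in Hv. exists v. split; [|apply HQ]; auto.
  - intros (v & Hv & Hq). exists v. split; [auto using dom_is_num|].
    split; [now apply Hn|now apply HQ].
Qed.

Lemma sat_fallN k env q Q :
  params k env -> (forall v, is_num v -> (sat (scons v env) q <-> Q v)) ->
  (sat env (fallN k q) <-> forall v, is_num v -> Q v).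
Proof.
  intros Hk HQ.
  assert (Hn : forall v, sat (scons v env) (fnum (S k) 0) <-> is_num v)
    by (intros v; apply (sat_fnum (S k) (scons v env)); exact Hk).
  split.
  - intros H v Hv. apply HQ; auto. apply H; [auto using dom_is_num|now apply Hn].
  - intros H v _ Hv. apply Hn in Hv. apply HQ; auto.
Qed.

Definition arithmetic : Prop :=
  is_num (num 0) /\
  (forall y, is_num y -> is_num (conjg y x)) /\
  (forall y, is_num y -> forall y', is_num y' ->
    conjg y x = conjg y' x -> y = y') /\
  (forall y, is_num y -> conjg y x <> num 0) /\
  (exists g, dom g /\
    forall i, is_num i -> forall j, is_num j -> ~ related g i j) /\
  (forall g, dom g -> forall i, is_num i -> forall j, is_num j ->
    exists g', dom g' /\
      forall i', is_num i' -> forall j', is_num j' ->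
      (related g' i' j' <-> related g i' j' \/ i' = i /\ j' = j)).

Lemma and_iff (A A' B B' : Prop) :
  (A <-> A') -> (B <-> B') -> (A /\ B <-> A' /\ B').
Proof. tauto. Qed.

Lemma or_iff (A A' B B' : Prop) :
  (A <-> A') -> (B <-> B') -> (A \/ B <-> A' \/ B').
Proof. tauto. Qed.

Lemma imp_iff (A A' B B' : Prop) :
  (A <-> A') -> (B <-> B') -> ((A -> B) <-> (A' -> B')).
Proof. tauto. Qed.

Lemma ex_dom_iff (P Q : M -> Prop) :
  (forall v, P v <-> Q v) -> ((exists v, dom v /\ P v) <-> exists v, dom v /\ Q v).
Proof. firstorder. Qed.

Lemma all_dom_iff (P Q : M -> Prop) :
  (forall v, P v <-> Q v) -> ((forall v, dom v -> P v) <-> forall v, dom v -> Q v).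
Proof. firstorder. Qed.

Lemma sat_fax env : params 0 env -> (sat env fax <-> arithmetic).
Proof.
  intros H0. pose proof H0 as (Ex & Ez & Ep).
  assert (Hn : forall k env y, params k env ->
    (sat env (fnum k y) <-> is_num (env y))) by (intros; now apply sat_fnum).
  repeat apply and_iff.
  - split.
    + intros H. apply (Hn 1 (scons (num 0) env) 0 H0), H.
      * cbn. auto using dom_conjg.
      * cbn. now rewrite Ex, Ez.
    + intros H v _ E. apply (Hn 1 (scons v env) 0 H0). cbn in E |- *.
      rewrite E, Ex, Ez. exact H.
  - split.
    + intros H y Hy.
      apply (Hn 2 (scons (conjg y x) (scons y env)) 0 H0), H.
      * now apply dom_is_num.
      * apply dom_conjg; [now apply dom_is_num|assumption].
      * now apply (Hn 2 (scons _ (scons y env)) 1 H0).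
      * cbn. now rewrite Ex.
    + intros H y _ y' _ Hy E. apply (Hn 2 (scons y' (scons y env)) 1 H0) in Hy.
      apply (Hn 2 (scons y' (scons y env)) 0 H0). cbn in Hy, E |- *.
      rewrite E, Ex. now apply H.
  - apply sat_fallN; [exact H0|]. intros y Hy.
    apply (sat_fallN 1 (scons y env)); [exact H0|]. intros y' Hy'.
    cbn. rewrite Ex. reflexivity.
  - apply sat_fallN; [exact H0|]. intros y Hy. cbn. rewrite Ex, Ez. reflexivity.
  - apply ex_dom_iff. intros g.
    apply (sat_fallN 1 (scons g env)); [exact H0|]. intros i Hi.
    apply (sat_fallN 2 (scons i (scons g env))); [exact H0|]. intros j Hj.
    apply not_iff_compat, (sat_frel 3 (scons j (scons i (scons g env)))), H0.
  - apply all_dom_iff. intros g.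
    apply (sat_fallN 1 (scons g env)); [exact H0|]. intros i Hi.
    apply (sat_fallN 2 (scons i (scons g env))); [exact H0|]. intros j Hj.
    apply ex_dom_iff. intros g'.
    apply (sat_fallN 4 (scons g' (scons j (scons i (scons g env)))));
      [exact H0|]. intros i' Hi'.
    apply (sat_fallN 5 (scons i' (scons g' (scons j (scons i (scons g env))))));
      [exact H0|]. intros j' Hj'.
    set (env' := scons j' (scons i' (scons g' (scons j (scons i (scons g env)))))).
    assert (R1 := sat_frel 6 env' 2 1 0 H0). assert (R2 := sat_frel 6 env' 5 1 0 H0).
    change (sat env' (frel 6 2 1 0) <-> related g' i' j') in R1.
    change (sat env' (frel 6 5 1 0) <-> related g i' j') in R2.
    rewrite <- R1, <- R2. reflexivity.
Qed.

Hypothesis ax : arithmetic.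

Lemma num_is_num n : is_num (num n).
Proof. destruct ax as (A1 & A2 & _). induction n; [exact A1|now apply A2]. Qed.

Lemma num_succ_zero n : num (S n) <> num 0.
Proof. apply ax, num_is_num. Qed.

Lemma related_insert g i j :
  dom g -> is_num i -> is_num j ->
  exists g', dom g' /\ related g' i j /\
    forall i' j', is_num i' -> is_num j' ->
      (related g' i' j' <-> related g i' j' \/ i' = i /\ j' = j).
Proof.
  destruct ax as (_ & _ & _ & _ & _ & A6). intros Hg Hi Hj.
  destruct (A6 g Hg i Hi j Hj) as (g' & Hg' & H). exists g'.
  split; [assumption|split].
  - apply H; auto.
  - intros. now apply H.
Qed.

(** The model may have nonstandard numbers and [s] may contain stray pairs, but since the successor
    is injective, justifications can be followed from [num n] down to zero by an induction outside
    the model. *)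
Lemma recursion_value (F0 : M -> M -> Prop) (F1 : M -> M -> M -> M -> Prop)
  (c : nat -> nat) n s v :
  (forall v, is_num v -> F0 (num 0) v -> v = num (c 0)) ->
  (forall m v, m < n -> is_num v ->
    F1 (num (S m)) v (num m) (num (c m)) -> v = num (c (S m))) ->
  (forall i, is_num i -> forall v, is_num v -> related s i v ->
    (i = num 0 /\ F0 i v) \/
    exists j, is_num j /\ exists u, is_num u /\
      i = conjg j x /\ related s j u /\ F1 i v j u) ->
  is_num v -> related s (num n) v -> v = num (c n).
Proof.
  destruct ax as (_ & _ & A3 & A4 & _ & _). intros H0 H1 Hs. revert v.
  induction n as [|n IH]; intros v Hv Hr;
    destruct (Hs _ (num_is_num _) v Hv Hr) as [[E Hf]|(j & Hj & u & Hu & E & Hr' & Hf)].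
  - now apply H0.
  - symmetry in E. now apply A4 in E.
  - now apply num_succ_zero in E.
  - apply A3 in E; [|apply num_is_num|assumption]. subst j.
    assert (u = num (c n)) as -> by (apply IH; auto).
    apply H1; auto.
Qed.

(** The pairs of the course of values are inserted one by one into the empty relation; the last
    clause records that no other pair of numbers got in. *)
Lemma recursion_exists (c : nat -> nat) n :
  exists s, dom s /\ related s (num n) (num (c n)) /\
    forall i, is_num i -> forall v, is_num v -> related s i v ->
      (i = num 0 /\ v = num (c 0)) \/
      exists m, m < n /\ i = num (S m) /\ v = num (c (S m)) /\
        related s (num m) (num (c m)).
Proof.
  induction n as [|n IH].
  - destruct ax as (_ & _ & _ & _ & (g & Hg & Hempty) & _).
    destruct (related_insert g (num 0) (num (c 0))) as (s & Hs & Hr & H);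
      auto using num_is_num.
    exists s. repeat split; auto. intros i Hi v Hv Hiv. left.
    apply H in Hiv as [Hiv|[-> ->]]; auto using num_is_num.
    exfalso. eapply Hempty; [| |exact Hiv]; auto.
  - destruct IH as (g & Hg & Hgn & Hjust).
    destruct (related_insert g (num (S n)) (num (c (S n)))) as (s & Hs & Hr & H);
      auto using num_is_num.
    exists s. repeat split; auto. intros i Hi v Hv Hiv.
    apply H in Hiv as [Hiv|[-> ->]]; auto.
    + destruct (Hjust i Hi v Hv Hiv) as [|(m & Hm & Ei & Ev & Hr')]; auto.
      right. exists m. repeat split; auto. apply H; auto using num_is_num.
    + right. exists n. repeat split; auto. apply H; auto using num_is_num.
Qed.

(** The set grows from zero until it meets [y]. It cannot stop before [num n], because [y] is no
    smaller numeral, nor go on from there, because [F] holds at [num n]. *)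
Lemma search_value (F : M -> Prop) n s y :
  F (num n) -> (forall m, m < n -> y <> num m) ->
  related s (num 0) (num 0) ->
  (forall i, is_num i -> related s i (num 0) ->
    i = y \/ ~ F i /\
      exists i', is_num i' /\ i' = conjg i x /\ related s i' (num 0)) ->
  y = num n.
Proof.
  intros Hn Hlt H0 Hs.
  assert (Hr : forall m, m <= n -> related s (num m) (num 0)).
  { induction m as [|m IH]; intros Hm; [assumption|].
    destruct (Hs (num m)) as [E|[_ (i' & _ & -> & Hi')]];
      [apply num_is_num|apply IH; lia| |assumption].
    symmetry in E. now apply Hlt in E. }
  destruct (Hs (num n)) as [E|[Hc _]]; auto using num_is_num. contradiction.
Qed.

(** A set is coded as the numbers related to zero, so the course of values of the constant function
    0 serves as an initial segment. *)
Lemma search_exists n :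
  exists s, dom s /\ related s (num 0) (num 0) /\
    forall i, is_num i -> related s i (num 0) ->
      i = num n \/ exists m, m < n /\ i = num m /\ related s (num (S m)) (num 0).
Proof.
  destruct (recursion_exists (fun _ => 0) n) as (s & Hs & Hsn & H).
  (* The justification clause leads only from a pair to its predecessor, hence the descent from
     [n]. *)
  assert (Hr : forall m, m <= n -> related s (num (n - m)) (num 0)).
  { induction m as [|m IH]; intros Hm; [now rewrite Nat.sub_0_r|].
    destruct (H _ (num_is_num (n - m)) _ (num_is_num 0)) as [[E _]|(m' & _ & E & _ & Hr)];
      [apply IH; lia| |].
    - replace (n - m) with (S (n - S m)) in E by lia. now apply num_succ_zero in E.
    - replace (n - m) with (S (n - S m)) in E by lia.
      destruct ax as (_ & _ & A3 & _).
      assert (num (n - S m) = num m') as -> by (apply A3; auto using num_is_num).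
      exact Hr. }
  assert (Hr' : forall m, m <= n -> related s (num m) (num 0)).
  { intros m Hm. replace m with (n - (n - m)) by lia. apply Hr. lia. }
  exists s. repeat split; auto with arith. intros i Hi Hi0.
  assert (Hle : exists m, m <= n /\ i = num m).
  { destruct (H i Hi _ (num_is_num 0) Hi0) as [[-> _]|(m & Hm & -> & _)].
    - exists 0. auto with arith.
    - exists (S m). auto. }
  destruct Hle as (m & Hm & ->).
  destruct (Nat.eq_dec m n) as [->|Hne]; [now left|right].
  exists m. repeat split; [lia|]. apply Hr'. lia.
Qed.

Lemma map_scons (v : M) env l : map (scons v env) (map S l) = map env l.
Proof. rewrite map_map. reflexivity. Qed.

(** Both implications are proved together because the formula of a function occurs negated in the
    one for unbounded search. *)
Lemma frep_correct f : forall k xs y env ns m,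
  params k env -> map env xs = map num ns -> is_num (env y) -> reval f ns m ->
  (sat env (frep f k xs y) <-> env y = num m).
Proof.
  induction f as [| |i|f gs IHf IHgs|f g IHf IHg|f IHf] using rfun_nested_ind;
    intros k xs y env ns m Hk Hxs Hy Hev; pose proof Hk as (Ex & Ez & Ep).
  - inversion Hev; subst. cbn. rewrite Ex, Ez. reflexivity.
  - inversion Hev; subst. destruct xs, ns; try discriminate; cbn.
    + rewrite Ex, Ez. reflexivity.
    + injection Hxs as E _. rewrite E, Ex. reflexivity.
  - inversion Hev; subst. cbn -[nth].
    replace (teval mul inv one env (nth i (map tvar xs) (tzero k)))
      with (num (nth i ns 0)); [reflexivity|].
    clear - Hxs Ex Ez. revert i ns Hxs.
    induction xs as [|v xs IH]; intros i [|n ns] Hxs; try discriminate.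
    + destruct i; cbn; now rewrite Ex, Ez.
    + injection Hxs as E Hxs. destruct i; cbn; [now rewrite E|now apply IH].
  - inversion Hev as [| | |? ? ? ms ? Hgs Hf| | |]; subst. cbn [frep].
    clear Hev Ex Ez Ep.
    (* The claim is generalised to a list [ns'] of arguments already computed and held by the
       variables [ys]. *)
    enough (Hgo : forall ys ns', map env ys = map num ns' -> reval f (ns' ++ ms) m ->
              sat env (fcomp frep f gs k xs ys y) <-> env y = num m)
      by (now apply (Hgo [] [])).
    clear Hf. revert k xs y env Hk Hxs Hy ms Hgs.
    induction IHgs as [|g gs IHg _ IH];
      intros k xs y env Hk Hxs Hy ms Hgs ys ns' Hys Hf;
      inversion Hgs as [|? a ? ms' Hg Hgs']; subst.
    + rewrite app_nil_r in Hf. cbn. now apply (IHf k ys y env ns').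
    + cbn [fcomp].
      rewrite sat_fexN with (Q := fun v => v = num a /\ env y = num m); auto.
      * split; [intros (v & _ & _ & ?)|intros ?; exists (num a)];
          auto using num_is_num.
      * intros v Hv. cbn [Defs.sat].
        rewrite (IHg (S k) (map S xs) 0 (scons v env) ns a);
          auto; [|now rewrite map_scons]. cbn [scons].
        split; intros [-> H]; (split; [reflexivity|]); revert H;
          apply (IH (S k) (map S xs) (S y) (scons (num a) env))
            with (ms := ms') (ns' := ns' ++ [a]);
          auto; try (rewrite ?map_app, map_scons; cbn; congruence);
          rewrite <- app_assoc; exact Hf.
  - destruct ns as [|n ns]; [inversion Hev|].
    destruct xs as [|v xs]; [discriminate|]. injection Hxs as Ev Hxs.
    apply reval_prec_inv in Hev as (c & <- & Hf & Hg).
    set (e1 s := scons s env).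
    set (e3 s i v := scons v (scons i (e1 s))).
    set (e5 s i v j u := scons u (scons j (e3 s i v))).
    set (F0 s i v := sat (e3 s i v) (frep f (3 + k) (map (Nat.add 3) xs) 0)).
    set (F1 s i v j u := sat (e5 s i v j u)
           (frep g (5 + k) (1 :: 0 :: map (Nat.add 5) xs) 2)).
    assert (HF0 : forall s i u, is_num u -> (F0 s i u <-> u = num (c 0))).
    { intros s i u Hu. apply IHf with (ns := ns); auto.
      rewrite map_map. exact Hxs. }
    assert (HF1 : forall s i u j, j < n -> is_num u ->
              (F1 s i u (num j) (num (c j)) <-> u = num (c (S j)))).
    { intros s i u j Hj Hu. apply IHg with (ns := j :: c j :: ns); auto.
      cbn [map]. f_equal. f_equal. rewrite map_map. exact Hxs. }
    assert (Hsat : sat env (frep (RPrec f g) k (v :: xs) y) <->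
      exists s, dom s /\ related s (env v) (env y) /\
        forall i, is_num i -> forall w, is_num w -> related s i w ->
          (i = num 0 /\ F0 s i w) \/
          exists j, is_num j /\ exists u, is_num u /\
            i = conjg j x /\ related s j u /\ F1 s i w j u).
    { cbn [frep Defs.sat]. apply ex_dom_iff. intros s.
      apply and_iff; [apply (sat_frel (S k) (e1 s)), Hk|].
      apply (sat_fallN (1 + k) (e1 s)); [exact Hk|]. intros i Hi.
      apply (sat_fallN (2 + k) (scons i (e1 s))); [exact Hk|]. intros w Hw.
      apply imp_iff; [apply (sat_frel (3 + k) (e3 s i w)), Hk|].
      apply or_iff.
      - apply and_iff; [|reflexivity]. cbn. rewrite Ex, Ez. reflexivity.
      - apply (sat_fexN (3 + k) (e3 s i w)); [exact Hk|]. intros j Hj.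
        apply (sat_fexN (4 + k) (scons j (e3 s i w))); [exact Hk|]. intros u Hu.
        apply and_iff; [cbn; rewrite Ex; reflexivity|].
        apply and_iff; [|reflexivity].
        apply (sat_frel (5 + k) (e5 s i w j u)), Hk. }
    rewrite Hsat, Ev. cbn [hd]. split.
    + intros (s & Hs & Hr & H).
      apply (recursion_value (F0 s) (F1 s)) with (s := s); auto.
      * intros w Hw. now apply HF0.
      * intros m w Hm Hw. now apply HF1.
    + intros ->. destruct (recursion_exists c n) as (s & Hs & Hr & H).
      exists s. repeat split; auto. intros i Hi w Hw Hiw.
      destruct (H i Hi w Hw Hiw) as [[-> ->]|(m & Hm & -> & -> & Hr')].
      * left. split; [reflexivity|]. apply HF0; auto using num_is_num.
      * right. exists (num m). split; [apply num_is_num|].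
        exists (num (c m)). split; [apply num_is_num|]. repeat split; auto.
        apply HF1; auto using num_is_num.
  - inversion Hev as [| | | | | |? ? ? Hz Hnz]; subst.
    set (e1 o := scons o env).
    set (e3 o s i := scons i (scons s (e1 o))).
    set (F s i := sat (e3 (num 0) s i) (frep f (3 + k) (0 :: map (Nat.add 3) xs) 2)).
    assert (HFm : forall s, F s (num m)).
    { intros s. apply IHf with (ns := m :: ns) (m := 0); auto.
      - cbn [map]. f_equal. rewrite map_map. exact Hxs.
      - apply (num_is_num 0). }
    assert (HFlt : forall s j, j < m -> ~ F s (num j)).
    { intros s j Hj Hf. destruct (Hnz j Hj) as (a & Ha).
      apply IHf with (ns := j :: ns) (m := S a) in Hf; auto.
      - symmetry in Hf. now apply num_succ_zero in Hf.
      - cbn [map]. f_equal. rewrite map_map. exact Hxs.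
      - apply (num_is_num 0). }
    (* The value of [y] is still open: this is used with some [j < m], to refute [y = num j], and
       with [m] itself. *)
    assert (Hy0 : forall ns' a, env y :: map num ns = map num ns' -> reval f ns' a ->
              (sat (e1 (num 0)) (frep f (S k) (S y :: map S xs) 0) <-> num 0 = num a)).
    { intros ns' a E Ha. apply (IHf (S k) (S y :: map S xs) 0 (e1 (num 0)) ns' a); auto.
      - cbn [map]. unfold e1. rewrite map_scons, Hxs. exact E.
      - apply (num_is_num 0). }
    assert (Hsat : sat env (frep (RMu f) k xs y) <->
      exists o, is_num o /\ o = num 0 /\
        sat (e1 o) (frep f (S k) (S y :: map S xs) 0) /\
        exists s, dom s /\ related s o o /\
          forall i, is_num i -> related s i o ->
            i = env y \/
            ~ sat (e3 o s i) (frep f (3 + k) (0 :: map (Nat.add 3) xs) 2) /\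
            exists i', is_num i' /\ i' = conjg i x /\ related s i' o).
    { cbn [frep]. apply sat_fexN; [exact Hk|]. intros o Ho.
      apply and_iff; [cbn; rewrite Ex, Ez; reflexivity|].
      apply and_iff; [reflexivity|]. apply ex_dom_iff. intros s.
      apply and_iff; [apply (sat_frel (2 + k) (scons s (e1 o))), Hk|].
      apply (sat_fallN (2 + k) (scons s (e1 o))); [exact Hk|]. intros i Hi.
      apply imp_iff; [apply (sat_frel (3 + k) (e3 o s i)), Hk|].
      apply or_iff; [reflexivity|]. apply and_iff; [reflexivity|].
      apply (sat_fexN (3 + k) (e3 o s i)); [exact Hk|]. intros i' Hi'.
      apply and_iff; [cbn; rewrite Ex; reflexivity|].
      apply (sat_frel (4 + k) (scons i' (e3 o s i))), Hk. }
    rewrite Hsat. split.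
    + intros (o & _ & -> & Hf & s & Hs & Hs0 & H).
      apply (search_value (F s) m s); auto.
      intros j Hj E. destruct (Hnz j Hj) as (a & Ha).
      apply (Hy0 (j :: ns) (S a)) in Hf; [|cbn; congruence|assumption].
      symmetry in Hf. now apply num_succ_zero in Hf.
    + intros E. exists (num 0). split; [apply num_is_num|].
      split; [reflexivity|]. split.
      { apply (Hy0 (m :: ns) 0); auto. cbn. congruence. }
      destruct (search_exists m) as (s & Hs & Hs0 & H).
      exists s. repeat split; auto. intros i Hi Hi0.
      destruct (H i Hi Hi0) as [->|(j & Hj & -> & Hr)]; [now left|right].
      split; [now apply HFlt|]. exists (num (S j)). repeat split; auto using num_is_num.
Qed.
End Representability.

(** * Hereditary undecidability by diagonalisation *)

Fixpoint tnum (k n : nat) : term :=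
  match n with 0 => tzero k | S n => tsucc k (tnum k n) end.

(** The outer quantifiers bind [p], [z], [x]; the numeral reaches [q] through an equation instead of
    a substitution, so the code is obtained by pairing alone. With [fax] as a hypothesis inside the
    sentence, even a subtheory without these axioms can be diagonalised. *)
Definition fdiag (n : nat) (q : form) : form :=
  fall (fall (fall (fimp fax (fall (fimp (feq (tvar 0) (tnum 1 n)) q))))).

Definition rpair (f g : rfun) : rfun := RComp rcpair [f; g].

Lemma reval_pair f g xs a b :
  reval f xs a -> reval g xs b -> reval (rpair f g) xs (cpair a b).
Proof. intros. eapply reval_comp2; eauto using reval_cpair. Qed.

Definition rnumcode : rfun :=
  RPrec (rconst (code_term (tzero 1)))
    (rpair (rconst 3) (rpair (rconst (code_term (tinv (tvar 1))))
      (rpair (rconst 3) (rpair (RProj 1) (rconst (code_term (tvar 1))))))).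

Lemma reval_numcode n : reval rnumcode [n] (code_term (tnum 1 n)).
Proof.
  induction n as [|n IH].
  - apply ev_prec0, reval_const.
  - eapply ev_precS; [exact IH|].
    repeat first [apply reval_pair|apply reval_const].
    apply (ev_proj 1 [n; code_term (tnum 1 n)]).
Qed.

(* The codes [a] of [fax] and [b] of a variable are kept abstract: they are huge
   unary numbers which must not be computed. *)
Definition rdiag (a b : nat) : rfun :=
  rpair (rconst 6) (rpair (rconst 6) (rpair (rconst 6) (rpair (rconst 5)
    (rpair (rconst a) (rpair (rconst 6) (rpair (rconst 5)
      (rpair (rpair (rconst 1) (rpair (rconst b) rnumcode)) (RProj 0)))))))).

Lemma reval_diag_aux a b n :
  reval (rdiag a b) [n]
    (cpair 6 (cpair 6 (cpair 6 (cpair 5 (cpair a (cpair 6 (cpair 5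
      (cpair (cpair 1 (cpair b (code_term (tnum 1 n)))) n)))))))).
Proof.
  unfold rdiag. repeat first [apply reval_pair|apply reval_const].
  - apply reval_numcode.
  - apply (ev_proj 0 [n]).
Qed.

Local Opaque cpair.

Lemma reval_diag q :
  reval (rdiag (code_form fax) (code_term (tvar 0))) [code_form q]
    (code_form (fdiag (code_form q) q)).
Proof.
  assert (E : forall a n, code_form (fall (fall (fall (fimp a
      (fall (fimp (feq (tvar 0) (tnum 1 n)) q)))))) =
    cpair 6 (cpair 6 (cpair 6 (cpair 5 (cpair (code_form a) (cpair 6 (cpair 5
      (cpair (cpair 1 (cpair (code_term (tvar 0)) (code_term (tnum 1 n))))
        (code_form q)))))))) ) by reflexivity.
  unfold fdiag. rewrite E. apply reval_diag_aux.
Qed.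

(** The program is hidden behind an existential so that the large codes in it do not surface
    later. *)
Lemma diagonal_function f : exists chi, forall q m,
  reval f [code_form (fdiag (code_form q) q)] m -> reval chi [code_form q] m.
Proof.
  exists (RComp f [rdiag (code_form fax) (code_term (tvar 0))]).
  intros q m H. eapply reval_comp1; [apply reval_diag|exact H].
Qed.

Lemma tnum_closed n : term_closed 4 (tnum 1 n) = true.
Proof.
  induction n as [|n IH]; [reflexivity|]. cbn. now rewrite IH.
Qed.

Lemma fdiag_sentence n q : form_closed 4 q = true -> sentence (fdiag n q).
Proof.
  intros Hq. unfold sentence, fdiag. cbn [form_closed].
  now rewrite fax_closed, tnum_closed, Hq.
Qed.

Lemma teval_tnum (M : Type) (mul : M -> M -> M) inv one env k n :
  teval mul inv one env (tnum k n) = num M mul inv (env k) (env (S k)) n.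
Proof. induction n as [|n IH]; cbn; [reflexivity|]. now rewrite IH. Qed.

(* The sentence [fdiag n q] with [q] saying "[f] takes the value 0 at the code
   of [fdiag v v]" and [n] the code of [q] asserts its own rejection by [f]. *)
Theorem arithmetic_hereditarily_undecidable (M : Type) (dom : M -> Prop)
  (mul : M -> M -> M) (inv : M -> M) (one : M) (env : nat -> M) (x z p : M) :
  (forall a b, dom a -> dom b -> dom (mul a b)) ->
  (forall a, dom a -> dom (inv a)) ->
  dom x -> dom z -> dom p -> arithmetic M dom mul inv x z p ->
  hereditarily_undecidable (fun q => sentence q /\ sat dom mul inv one env q).
Proof.
  intros Hmul Hinv Hx Hz Hp Hax T HT Hcons [f Hf].
  destruct (diagonal_function f) as [chi Hchi].
  set (q := fex (fand (feq (tvar 0) (tzero 2)) (frep chi 2 [1] 0))).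
  assert (Hq : form_closed 4 q = true).
  { cbn -[frep]. apply frep_closed; auto with arith. }
  specialize (Hchi q). revert Hchi. generalize (code_form q) as n. intros n Hchi.
  set (D := fdiag n q).
  assert (HfD : T D /\ reval f [code_form D] 1 \/ ~ T D /\ reval f [code_form D] 0).
  { destruct (Hf (code_form D)) as [[(D' & HD & E) H1]|[HnD H0]]; [left|right].
    - apply code_form_inj in E. rewrite E in HD. exact (conj HD H1).
    - split; [|exact H0]. intros HD. apply HnD. exists D.
      exact (conj HD eq_refl). }
  clear Hf. revert Hchi HfD. fold D. generalize (code_form D) as c.
  intros c Hchi HfD.
  (* This is stated for all models at once: it is applied to the given one with value 1 and to an
     arbitrary model of [fax] with value 0. *)
  assert (Hsat : forall (M' : Type) (dom' : M' -> Prop) mul' inv' one' env' x' z' p' m,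
    (forall a b, dom' a -> dom' b -> dom' (mul' a b)) ->
    (forall a, dom' a -> dom' (inv' a)) ->
    dom' x' -> dom' z' -> arithmetic M' dom' mul' inv' x' z' p' ->
    params M' x' z' p' 1 env' -> env' 0 = num M' mul' inv' x' z' n ->
    reval f [c] m ->
    (sat dom' mul' inv' one' env' q <->
     num M' mul' inv' x' z' 0 = num M' mul' inv' x' z' m)).
  { intros M' dom' mul' inv' one' env' x' z' p' m Hmul' Hinv' Hx' Hz' Hax' Hpar E Hm.
    apply Hchi in Hm.
    assert (Hn : is_num M' dom' mul' inv' x' z' p' (num M' mul' inv' x' z' 0))
      by (apply num_is_num; auto).
    assert (Hrep : sat dom' mul' inv' one' (scons (num M' mul' inv' x' z' 0) env')
                     (frep chi 2 [1] 0) <->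
              num M' mul' inv' x' z' 0 = num M' mul' inv' x' z' m).
    { apply (frep_correct M' dom' mul' inv' one' x' z' p' Hmul' Hinv' Hx' Hz' Hax'
        chi 2 [1] 0 (scons (num M' mul' inv' x' z' 0) env') [n] m); auto.
      cbn [map]. now rewrite <- E. }
    assert (E0 : num M' mul' inv' x' z' 0 =
                 teval mul' inv' one' (scons (num M' mul' inv' x' z' 0) env') (tzero 2)).
    { destruct Hpar as (E1 & E2 & _). cbn. now rewrite E1, E2. }
    rewrite <- Hrep. split.
    - intros (v & _ & Ev & Hv).
      change (v = teval mul' inv' one' (scons (num M' mul' inv' x' z' 0) env') (tzero 2))
        in Ev.
      rewrite <- E0 in Ev. now rewrite Ev in Hv.
    - intros H. exists (num M' mul' inv' x' z' 0).
      split; [|split; [exact E0|exact H]].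
      now apply (dom_conjg M' dom' mul' inv'). }
  destruct HfD as [[HD H1]|[HnD H0]].
  (* If [f] accepts [D], then [D] is true in the given structure and yields that zero equals one. *)
  - apply HT in HD as [_ [_ HD]].
    specialize (HD p Hp z Hz x Hx).
    pose proof (dom_conjg M dom mul inv Hmul Hinv) as Hconj.
    assert (Hnum : dom (num M mul inv x z n)).
    { clear - Hconj Hx Hz. induction n; apply Hconj; auto. }
    assert (Hq1 : num M mul inv x z 0 = num M mul inv x z 1).
    { apply (Hsat M dom mul inv one
        (scons (num M mul inv x z n) (scons x (scons z (scons p env)))) x z p 1);
        auto; [repeat split|].
      apply HD; [|exact Hnum|cbn [teval scons]; now rewrite teval_tnum].
      apply (sat_fax M dom mul inv one x z p); auto. repeat split. }
    symmetry in Hq1. revert Hq1.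
    apply num_succ_zero with (dom := dom) (p := p); auto.
  (* If [f] rejects [D], then [D] is true in every structure, so closure under consequence puts it
     into [T]. *)
  - apply HnD. apply Hcons; [now apply fdiag_sentence|].
    intros M' mul' inv' one' _ env' p' _ z' _ x' _ Hax' v _ Ev.
    assert (Har : arithmetic M' (fun _ => True) mul' inv' x' z' p').
    { revert Hax'. apply sat_fax; auto. repeat split. }
    apply (Hsat M' (fun _ => True) mul' inv' one'
      (scons v (scons x' (scons z' (scons p' env')))) x' z' p' 0); auto.
    + repeat split.
    + etransitivity; [exact Ev|apply teval_tnum].
Qed.

Local Open Scope R_scope.

(** * Piecewise affine homeomorphisms *)

(* [l] lists the lengths and slopes of the successive pieces of a map that
   starts at the point [a], where it takes the value [y]. *)
Fixpoint pl (a y : R) (l : list (R * R)) (t : R) : R :=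
  match l with
  | [] => y + (t - a)
  | (d, s) :: l =>
      if Rlt_dec t (a + d) then y + s * (t - a) else pl (a + d) (y + s * d) l t
  end.

Definition pl_map (l : list (R * R)) (t : R) : R :=
  if Rlt_dec t 0 then t else pl 0 0 l t.

Fixpoint source_length (l : list (R * R)) : R :=
  match l with [] => 0 | (d, s) :: l => d + source_length l end.

Fixpoint target_length (l : list (R * R)) : R :=
  match l with [] => 0 | (d, s) :: l => s * d + target_length l end.

Definition positive_piece (c : R * R) : Prop := 0 < fst c /\ 0 < snd c.

Lemma source_length_pos l : Forall positive_piece l -> 0 <= source_length l.
Proof.
  induction 1 as [|[d s] l [Hd Hs] _ IH]; cbn in *; lra.
Qed.

Lemma pl_start a y l : Forall positive_piece l -> pl a y l a = y.
Proof.
  intros H. destruct H as [|[d s] l [Hd Hs] _]; cbn in *; [lra|].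
  destruct (Rlt_dec a (a + d)); lra.
Qed.

Lemma pl_end l : Forall positive_piece l -> forall a y t,
  a + source_length l <= t ->
  pl a y l t = y + target_length l + (t - a - source_length l).
Proof.
  induction 1 as [|[d s] l [Hd Hs] Hl IH]; intros a y t Ht; cbn in *; [lra|].
  pose proof (source_length_pos l Hl).
  destruct (Rlt_dec t (a + d)); [lra|]. rewrite IH; lra.
Qed.

(** The constants are the least and the greatest slope, counting the slope 1 of the tail. The lower
    bound will give injectivity, the upper one continuity. *)
Lemma pl_bilipschitz l : Forall positive_piece l ->
  exists m M, 0 < m /\ 0 < M /\ forall a y t u, a <= t -> t <= u ->
    m * (u - t) <= pl a y l u - pl a y l t <= M * (u - t).
Proof.
  induction 1 as [|[d s] l [Hd Hs] Hl (m & M & Hm & HM & IH)]; cbn in *.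
  - exists 1, 1. split; [lra|split; [lra|]]. intros. lra.
  - exists (Rmin s m), (Rmax s M).
    pose proof (Rmin_l s m). pose proof (Rmin_r s m).
    pose proof (Rmax_l s M). pose proof (Rmax_r s M).
    split; [now apply Rmin_glb_lt|split; [lra|]].
    intros a y t u Ht Hu.
    destruct (Rlt_dec u (a + d)), (Rlt_dec t (a + d)); try lra.
    + nra.
    + destruct (IH (a + d) (y + s * d) (a + d) u) as [H3 H4]; [lra|lra|].
      rewrite pl_start in H3, H4 by assumption.
      assert (Rmin s m * (u - (a + d)) <= m * (u - (a + d))) by nra.
      assert (M * (u - (a + d)) <= Rmax s M * (u - (a + d))) by nra.
      assert (Rmin s m * (a + d - t) <= s * (a + d - t)) by nra.
      assert (s * (a + d - t) <= Rmax s M * (a + d - t)) by nra.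
      lra.
    + destruct (IH (a + d) (y + s * d) t u) as [H3 H4]; [lra|lra|]. nra.
Qed.

Lemma pl_surjective l : Forall positive_piece l ->
  forall a y v, y <= v -> exists t, a <= t /\ pl a y l t = v.
Proof.
  induction 1 as [|[d s] l [Hd Hs] Hl IH]; intros a y v Hv; cbn in *.
  - exists (a + (v - y)). lra.
  - destruct (Rlt_dec v (y + s * d)) as [Hlt|Hge].
    + exists (a + (v - y) / s).
      assert (E : s * ((v - y) / s) = v - y) by (field; lra).
      assert (0 <= (v - y) / s) by (apply Rmult_le_reg_l with s; lra).
      assert ((v - y) / s < d) by (apply Rmult_lt_reg_l with s; lra).
      split; [lra|]. destruct (Rlt_dec _ _); [|lra].
      replace (a + (v - y) / s - a) with ((v - y) / s) by ring. lra.
    + destruct (IH (a + d) (y + s * d) v) as (t & Ht & Hvt); [lra|].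
      exists t. split; [lra|]. destruct (Rlt_dec t (a + d)); [lra|assumption].
Qed.

Lemma pl_pieces (Lam A : R -> Prop) :
  (forall a b, A a -> A b -> A (a + b)) ->
  (forall l a, Lam l -> A a -> A (l * a)) ->
  forall l, Forall positive_piece l ->
  Forall (fun c => A (fst c) /\ Lam (snd c)) l ->
  forall a y, A a -> A y ->
  exists (c lam b : nat -> R),
    c 0%nat = a /\ c (length l) = a + source_length l /\
    (forall i, (i < length l)%nat -> c i < c (S i)) /\
    (forall i, (i <= length l)%nat -> A (c i) /\ a <= c i) /\
    (forall i, (i < length l)%nat ->
      Lam (lam i) /\ A (pl a y l (c i)) /\
      forall t, c i <= t < c (S i) -> pl a y l t = lam i * t + b i).
Proof.
  intros Hadd Hmul l. induction 1 as [|[d s] l [Hd Hs] Hl IH]; intros HA a y Ha Hy.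
  - exists (fun _ => a), (fun _ => 1), (fun _ => 0). cbn.
    repeat split; try lra; try (intros; lia); auto.
  - inversion HA as [|? ? [Ad Ls] HA']; subst. cbn [fst snd] in *.
    destruct (IH HA' (a + d) (y + s * d)) as (c & lam & b & H0 & Hn & Hlt & Hc & Hp);
      auto.
    exists (fun i => match i with O => a | S i => c i end),
           (fun i => match i with O => s | S i => lam i end),
           (fun i => match i with O => y - s * a | S i => b i end).
    cbn [length source_length]. split; [reflexivity|].
    split; [rewrite Hn; lra|]. split; [|split].
    + intros [|i] Hi; [rewrite H0; lra|]. apply Hlt. lia.
    + intros [|i] Hi; [split; [assumption|lra]|].
      destruct (Hc i) as [H1 H2]; [lia|]. split; [assumption|lra].
    + intros [|i] Hi.
      * split; [assumption|]. split.
        { now rewrite pl_start by (constructor; [split|]; auto). }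
        intros t Ht. rewrite H0 in Ht. cbn. destruct (Rlt_dec t (a + d)); lra.
      * destruct (Hp i) as (H1 & H2 & H3); [lia|].
        destruct (Hc i) as [_ H4]; [lia|]. split; [assumption|]. cbn. split.
        -- destruct (Rlt_dec (c i) (a + d)); [lra|assumption].
        -- intros t Ht. destruct (Rlt_dec t (a + d)); [lra|]. now apply H3.
Qed.

(** Equal source and target lengths make the tail of [pl], which has slope 1, the identity beyond
    [r]. *)
Lemma pl_map_inF r Lam A l :
  admissible r Lam A -> Forall positive_piece l ->
  Forall (fun c => A (fst c) /\ Lam (snd c)) l ->
  source_length l = r -> target_length l = r ->
  inF r Lam A (pl_map l).
Proof.
  intros (Hr & HLpos & HL1 & HLm & HLi & A0 & Aadd & Aopp & Ar & Amul) Hl HA Hs Ht.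
  destruct (pl_bilipschitz l Hl) as (m & M & Hm & HM & Hlip).
  assert (Hpos : forall t, 0 <= t -> pl_map l t = pl 0 0 l t)
    by (intros t H; unfold pl_map; destruct (Rlt_dec t 0); [lra|reflexivity]).
  assert (H0 : pl_map l 0 = 0) by (rewrite Hpos, pl_start; auto; lra).
  assert (Hend : forall t, r <= t -> pl_map l t = t)
    by (intros t H; rewrite Hpos, pl_end; auto; lra).
  assert (Hb : forall t u, 0 <= t -> t <= u ->
             m * (u - t) <= pl_map l u - pl_map l t <= M * (u - t)).
  { intros t u H1 H2. rewrite !Hpos by lra. apply Hlip; lra. }
  split; [split; [split; [|split; [|split]]|]|].
  - intros t [H1 H2]. pose proof (Hb 0 t). pose proof (Hb t r) as H3.
    rewrite H0 in *. rewrite (Hend r) in H3 by lra. split; nra.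
  - intros v [H1 H2]. destruct (pl_surjective l Hl 0 0 v H1) as (t & H3 & H4).
    exists t. rewrite Hpos by assumption. split; [|assumption]. split; [assumption|].
    apply Rnot_le_lt. intros H5. rewrite <- Hpos, Hend in H4; lra.
  - intros t u [H1 _] [H2 _] E.
    destruct (Rle_lt_dec t u); [pose proof (Hb t u)|pose proof (Hb u t)]; nra.
  - intros t H. unfold in_r in H. destruct (Rlt_dec t 0) as [Hn|Hn].
    + unfold pl_map. now destruct (Rlt_dec t 0).
    + apply Hend. lra.
  - destruct (pl_pieces Lam A Aadd Amul l Hl HA 0 0 A0 A0)
      as (c & lam & b & Hc0 & Hcn & Hlt & Hc & Hp).
    exists (length l), c, lam, b. split; [assumption|].
    split; [rewrite Hcn; lra|]. split; [assumption|]. split; [apply Hc|].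
    intros i Hi. destruct (Hc i) as [_ H1]; [lia|].
    destruct (Hp i Hi) as (H2 & H3 & H4). rewrite Hpos by lra.
    repeat split; auto. intros t Hti. rewrite Hpos by lra. now apply H4.
  - intros t [H1 _] eps Heps. exists (eps / M). split; [now apply Rdiv_lt_0_compat|].
    intros u [H2 _] Hd.
    assert (Hd' : M * Rabs (u - t) < eps).
    { apply Rmult_lt_compat_l with (r := M) in Hd; [|assumption].
      replace (M * (eps / M)) with eps in Hd by (field; lra). assumption. }
    apply Rle_lt_trans with (2 := Hd').
    destruct (Rle_lt_dec t u).
    + pose proof (Hb t u). rewrite !Rabs_right; nra.
    + pose proof (Hb u t). rewrite !Rabs_left1; nra.
Qed.

Lemma breakpoint_interval (a : nat -> R) n t :
  a 0%nat <= t -> t < a n -> exists i, (i < n)%nat /\ a i <= t < a (S i).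
Proof.
  intros H0. induction n as [|n IH]; intros Hn; [lra|].
  destruct (Rlt_le_dec t (a n)) as [H|H].
  - destruct (IH H) as (i & Hi & Ht). exists i. split; [lia|assumption].
  - exists n. split; [lia|lra].
Qed.

Lemma right_germ r Lam A f t :
  pw_affine r Lam A f -> in_r r t ->
  exists eps mu, 0 < eps /\ Lam mu /\
    forall s, 0 <= s < eps -> f (t + s) = f t + mu * s.
Proof.
  intros (n & a & lam & b & H0 & Hn & Hlt & _ & Hp) [Ht Htr].
  destruct (breakpoint_interval a n t) as (i & Hi & Hti); [lra|lra|].
  destruct (Hp i Hi) as (HL & _ & Hf). exists (a (S i) - t), (lam i).
  split; [lra|]. split; [assumption|]. intros s Hs. rewrite !Hf; [ring|lra|lra].
Qed.

(** Group elements may jump, so the left limit [c] can differ from [f t]. *)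
Lemma left_germ r Lam A f t :
  pw_affine r Lam A f -> 0 < t <= r ->
  exists eps nu c, 0 < eps /\
    forall s, 0 < s < eps -> f (t - s) = c - nu * s.
Proof.
  intros (n & a & lam & b & H0 & Hn & Hlt & _ & Hp) [Ht Htr].
  assert (H : forall k, (k <= n)%nat -> t <= a k ->
            exists i, (i < n)%nat /\ a i < t <= a (S i)).
  { induction k as [|k IH]; intros Hk Hk'; [lra|].
    destruct (Rle_lt_dec t (a k)); [apply IH; [lia|assumption]|].
    exists k. split; [lia|lra]. }
  destruct (H n) as (i & Hi & Hti); [lia|lra|].
  destruct (Hp i Hi) as (_ & _ & Hf).
  exists (t - a i), (lam i), (lam i * t + b i).
  split; [lra|]. intros s Hs. rewrite Hf; [ring|lra].
Qed.

Lemma pow_unbounded l M : 1 < l -> exists n, M < l ^ n.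
Proof.
  intros Hl. destruct (Pow_x_infinity l) with (b := M + 1) as [n Hn].
  - rewrite Rabs_right; lra.
  - exists n. specialize (Hn n (le_n n)).
    rewrite Rabs_right in Hn; [lra|]. left. apply pow_lt. lra.
Qed.

(** Reduction of [mu] modulo the powers of [l], with two cases in place of negative exponents. *)
Lemma slope_normalisation l mu : 1 < l -> 0 < mu ->
  exists n, 1 <= mu / l ^ n < l \/ 1 <= mu * l ^ n < l.
Proof.
  intros Hl Hmu. assert (Hp : forall n, 0 < l ^ n) by (intros; apply pow_lt; lra).
  destruct (Rle_lt_dec 1 mu) as [H|H].
  - assert (Hex : exists n, l ^ n <= mu < l ^ S n).
    { destruct (pow_unbounded l mu Hl) as [N HN].
      induction N as [|N IH]; [cbn in HN; lra|].
      destruct (Rlt_le_dec mu (l ^ N)); [auto|]. exists N. lra. }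
    destruct Hex as (n & Hn1 & Hn2). exists n. left. specialize (Hp n).
    cbn in Hn2. split.
    + apply Rmult_le_reg_r with (l ^ n); [assumption|].
      replace (mu / l ^ n * l ^ n) with mu by (field; lra). lra.
    + apply Rmult_lt_reg_r with (l ^ n); [assumption|].
      replace (mu / l ^ n * l ^ n) with mu by (field; lra). lra.
  - destruct (pow_unbounded l (/ mu) Hl) as [N HN].
    assert (HN' : 1 <= mu * l ^ N).
    { apply Rmult_lt_compat_l with (r := mu) in HN; [|assumption].
      rewrite Rinv_r in HN; lra. }
    clear HN. induction N as [|N IH]; [cbn in HN'; lra|].
    destruct (Rle_lt_dec 1 (mu * l ^ N)); [auto|].
    exists (S N). right. cbn in *. split; [assumption|]. nra.
Qed.

(** * Conjugation and supports of permutations *)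

(** [ginv] chooses preimages by [epsilon], so it is a two-sided inverse only for bijections of the
    whole line. *)
Definition permutation (f : R -> R) : Prop :=
  forall t, ginv f (f t) = t /\ f (ginv f t) = t.

Definition conj_map : (R -> R) -> (R -> R) -> R -> R := conjg (R -> R) gmul ginv.

Definition commuting : (R -> R) -> (R -> R) -> Prop := commute (R -> R) gmul.

Lemma bij_r_permutation r f : bij_r r f -> permutation f.
Proof.
  intros (Hin & Hsurj & Hinj & Hout).
  assert (Hf : forall s, f (ginv f s) = s).
  { intros s. apply (epsilon_spec (inhabits 0) (fun t => f t = s)).
    destruct (classic (in_r r s)) as [Hs|Hs].
    - destruct (Hsurj s Hs) as (t & _ & Ht). now exists t.
    - exists s. now apply Hout. }
  intros t. split; [|apply Hf].
  set (s := ginv f (f t)). assert (E : f s = f t) by apply Hf.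
  destruct (classic (in_r r t)) as [Ht|Ht], (classic (in_r r s)) as [Hs|Hs].
  - now apply Hinj.
  - apply Hin in Ht. rewrite <- E, (Hout s Hs) in Ht. contradiction.
  - apply Hin in Hs. rewrite E, (Hout t Ht) in Hs. contradiction.
  - now rewrite (Hout s Hs), (Hout t Ht) in E.
Qed.

Lemma permutation_injective f s t : permutation f -> f s = f t -> s = t.
Proof.
  intros Hf E. rewrite <- (proj1 (Hf s)), E. apply Hf.
Qed.

Lemma commuting_iff f g : commuting f g <-> forall t, g (f t) = f (g t).
Proof.
  split; intros H.
  - intros t. exact (f_equal (fun k => k t) H).
  - apply functional_extensionality, H.
Qed.

Lemma conj_map_apply f h q : permutation h -> conj_map f h (h q) = h (f q).
Proof.
  intros Hh. change (h (f (ginv h (h q))) = h (f q)). now rewrite (proj1 (Hh q)).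
Qed.

Lemma conj_map_unique f h g :
  permutation h -> (forall q, g (h q) = h (f q)) -> g = conj_map f h.
Proof.
  intros Hh Hg. apply functional_extensionality. intros t.
  rewrite <- (proj2 (Hh t)), conj_map_apply by assumption. apply Hg.
Qed.

Lemma conj_map_moves f h t : permutation h ->
  (conj_map f h t <> t <-> exists q, f q <> q /\ t = h q).
Proof.
  intros Hh. split.
  - intros H. exists (ginv h t). rewrite (proj2 (Hh t)). split; [|reflexivity].
    intros E. apply H. rewrite <- (proj2 (Hh t)) at 1.
    rewrite conj_map_apply, E by assumption. apply Hh.
  - intros (q & Hq & ->) E. rewrite conj_map_apply in E by assumption.
    now apply Hq, (permutation_injective h).
Qed.

(** This serves for conjugators known only on a fundamental domain. If [f] fixes [q] but the
    conjugate by [h] moved [h' q], this point would be [h q' = h' q'] for a moved [q'], forcing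
    [q = q']. *)
Lemma conj_map_agree f h h' :
  permutation f -> permutation h -> permutation h' ->
  (forall q, f q <> q -> h q = h' q) -> conj_map f h = conj_map f h'.
Proof.
  intros Hf Hh Hh' H. apply conj_map_unique; [assumption|]. intros q.
  destruct (classic (f q = q)) as [E|E].
  - rewrite E. apply NNPP. intros Hn. apply conj_map_moves in Hn; [|assumption].
    destruct Hn as (q' & Hq' & E'). rewrite (H q' Hq') in E'.
    apply permutation_injective in E'; [|assumption]. now subst q'.
  - rewrite <- (H q E), conj_map_apply by assumption. apply H.
    intros E'. now apply E, (permutation_injective f).
Qed.

Lemma conj_map_commuting f g h :
  permutation h -> commuting (conj_map f h) (conj_map g h) -> commuting f g.
Proof.
  intros Hh. rewrite !commuting_iff. intros H q. specialize (H (h q)).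
  rewrite !conj_map_apply in H by assumption. now apply (permutation_injective h).
Qed.

Lemma disjoint_commuting f g :
  permutation f -> permutation g ->
  (forall t, f t <> t -> g t <> t -> False) -> commuting f g.
Proof.
  intros Hf Hg H. apply commuting_iff. intros t.
  destruct (classic (f t = t)) as [Ef|Ef], (classic (g t = t)) as [Eg|Eg].
  - congruence.
  - rewrite Ef. apply NNPP. intros E. apply (H (g t)); [congruence|].
    intros E'. now apply Eg, (permutation_injective g).
  - rewrite Eg. apply NNPP. intros E. apply (H (f t)); [|congruence].
    intros E'. now apply Ef, (permutation_injective f).
  - destruct (H t); assumption.
Qed.

Lemma commuting_mul_right g s c :
  permutation s -> commuting s c -> (commuting (gmul g s) c <-> commuting g c).
Proof.
  rewrite !commuting_iff. unfold gmul. intros Hs Hsc. split; intros H t.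
  - apply (permutation_injective s); [assumption|]. rewrite <- Hsc. apply H.
  - rewrite Hsc. now rewrite H.
Qed.

Lemma commuting_mul_left g s c :
  permutation g -> commuting g c -> commuting (gmul g s) c -> commuting s c.
Proof.
  rewrite !commuting_iff. unfold gmul. intros Hg Hgc H t.
  specialize (H (ginv g t)). rewrite <- Hgc in H. now rewrite (proj2 (Hg t)) in H.
Qed.

(** * Three particular homeomorphisms *)

Section Generators.
Variables l e : R.
Hypothesis Hl : 4 <= l.
Hypothesis He : 0 < e.

(** Thus [e + u = l * e] ends the first piece that [shift] moves, and [e + l * u] is the midpoint of
    [[e, b]]. *)
Let u := (l - 1) * e.
Let b := e + 2 * l * u.
Let r := l * l * l * e.

(* [shift] moves exactly [(e, b)], with fundamental domain [[l e, e + l u)], into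
   which [squeeze] maps [(e, b)]; [half_shift] is the identity below [l e] and
   agrees with [shift] above [(2 l - 1) e]. The total length [l^3 e] leaves room to
   the right of [b] for the piece by which [squeeze] catches up with the identity. *)
Definition shift : R -> R := pl_map
  [(e, 1); (u, l); ((l - 1) * u, 1); (l * u, / l); (r - b, 1)].
Definition squeeze : R -> R := pl_map
  [(e, l); (2 * l * u, / l); ((2 * l - 3) * e, l);
   (r - (2 * l * l - 2) * e, 1)].
Definition half_shift : R -> R := pl_map
  [(l * e, 1); (u, l); ((l - 2) * u, 1); (l * u, / l); (r - b, 1)].

(** With these products as atoms, most comparisons of breakpoints become linear. *)
Lemma scale_facts :
  4 * e <= l * e /\ 4 * (l * e) <= l * l * e /\ 4 * (l * l * e) <= l * l * l * e /\
  / l * (l * e) = e /\ / l * (l * l * e) = l * e.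
Proof.
  assert (0 < l * e) by nra. assert (0 < l * l * e) by nra.
  repeat split; try nra; field; lra.
Qed.

Ltac pl_eval f :=
  unfold f, pl_map, b, u, r in *; cbn [pl];
  destruct scale_facts as (F1 & F2 & F3 & F4 & F5);
  repeat destruct (Rlt_dec _ _); try lra; try nra.

Lemma shift_fixed t : t <= e \/ b <= t -> shift t = t.
Proof. intros [H|H]; pl_eval shift. Qed.

Lemma shift_first t : e <= t <= l * e -> shift t = e + l * (t - e).
Proof. intros H. pl_eval shift. Qed.

Lemma shift_middle t : l * e <= t <= e + l * u -> shift t = t + (l - 1) * u.
Proof. intros H. pl_eval shift. Qed.

Lemma shift_last t : e + l * u <= t <= b -> shift t = b - (b - t) / l.
Proof. intros H. unfold Rdiv. pl_eval shift. Qed.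

Lemma squeeze_middle t : e <= t <= b -> squeeze t = l * e + (t - e) / l.
Proof. intros H. unfold Rdiv. pl_eval squeeze. Qed.

Lemma half_shift_fixed t : t <= l * e -> half_shift t = t.
Proof. intros H. pl_eval half_shift. Qed.

Lemma half_shift_eq_shift t : (2 * l - 1) * e <= t -> half_shift t = shift t.
Proof. intros H. unfold shift. pl_eval half_shift. Qed.

Lemma lengths_positive : 0 < e < b /\ b < r /\ 0 < u /\ u < l * u /\
  (3 * l - 2) * e <= e + l * u /\ b - l * u = e + l * u.
Proof.
  destruct scale_facts as (F1 & F2 & F3 & _). unfold b, u, r.
  repeat split; try lra; nra.
Qed.

(** The middle piece read as a transition from the distance to [e] to the distance to [b]. *)
Lemma shift_middle_last t : e + u <= t <= e + l * u ->
  shift t = b - ((l + 1) * u - (t - e)).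
Proof.
  intros H. rewrite shift_middle; unfold b, u in *; [ring|]. nra.
Qed.

Lemma shift_ge t : t <= shift t.
Proof.
  destruct lengths_positive as (H1 & H2 & H3 & H4 & _ & H5).
  destruct (Rle_lt_dec t e); [rewrite shift_fixed; lra|].
  destruct (Rle_lt_dec b t); [rewrite shift_fixed; lra|].
  destruct (Rle_lt_dec t (l * e)); [rewrite shift_first by lra; nra|].
  destruct (Rle_lt_dec t (e + l * u)); [rewrite shift_middle by lra; nra|].
  rewrite shift_last by lra.
  assert ((b - t) / l <= b - t); [|lra].
  apply Rmult_le_reg_l with l; [lra|].
  replace (l * ((b - t) / l)) with (b - t) by (field; lra). nra.
Qed.

Lemma shift_jump t : l * e <= t -> e + l * u <= shift t.
Proof.
  intros H. destruct (Rle_lt_dec t (e + l * u)).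
  - rewrite shift_middle by lra. unfold u in *. nra.
  - pose proof (shift_ge t). lra.
Qed.

Lemma shift_moves t : shift t <> t <-> e < t < b.
Proof.
  destruct lengths_positive as (H1 & H2 & H3 & H4 & _ & H5). split.
  - intros H. apply NNPP. intros Hn. apply H, shift_fixed. lra.
  - intros [Ha Hb] E.
    destruct (Rle_lt_dec t (l * e)); [rewrite shift_first in E by lra; nra|].
    destruct (Rle_lt_dec t (e + l * u)); [rewrite shift_middle in E by lra; nra|].
    rewrite shift_last in E by lra.
    assert (E' : l * ((b - t) / l) = b - t) by (field; lra).
    replace ((b - t) / l) with (b - t) in E' by lra. nra.
Qed.

Lemma squeeze_range t : e < t < b -> l * e < squeeze t < (3 * l - 2) * e.
Proof.
  intros H. rewrite squeeze_middle by lra.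
  assert (E : l * ((t - e) / l) = t - e) by (field; lra).
  unfold b, u in H. split; nra.
Qed.

Lemma squeeze_onto t : l * e < t < (3 * l - 2) * e -> exists q, e < q < b /\ squeeze q = t.
Proof.
  intros H. exists (e + l * (t - l * e)).
  assert (Hq : e < e + l * (t - l * e) < b) by (unfold b, u; split; nra).
  split; [assumption|]. rewrite squeeze_middle by lra. field. lra.
Qed.

Lemma half_shift_moves t : half_shift t <> t -> l * e < t < b.
Proof.
  intros H. split; apply Rnot_le_lt; intros Ht.
  - now apply H, half_shift_fixed.
  - apply H. rewrite half_shift_eq_shift; [apply shift_fixed; lra|].
    pose proof scale_facts. unfold b, u in *. nra.
Qed.

Fixpoint shift_pow (n : nat) (t : R) : R :=
  match n with O => t | S n => shift (shift_pow n t) end.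

Lemma shift_pow_add m n t : shift_pow (m + n) t = shift_pow m (shift_pow n t).
Proof. induction m as [|m IH]; cbn; [reflexivity|now rewrite IH]. Qed.

Lemma shift_pow_ge n t : t <= shift_pow n t.
Proof.
  induction n as [|n IH]; cbn; [lra|]. pose proof (shift_ge (shift_pow n t)). lra.
Qed.

Lemma shift_pow_jump n t : l * e <= t -> e + l * u <= shift_pow (S n) t.
Proof. intros H. cbn [shift_pow]. apply shift_jump. pose proof (shift_pow_ge n t). lra. Qed.

Lemma shift_pow_first n s : 0 <= s -> l ^ n * s <= l * u ->
  shift_pow n (e + s) = e + l ^ n * s.
Proof.
  intros Hs. induction n as [|n IH]; intros H; cbn in *; [ring|].
  assert (Hp : 0 <= l ^ n * s) by (apply Rmult_le_pos; [apply pow_le|]; lra).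
  assert (Hu : l ^ n * s <= u) by (apply Rmult_le_reg_l with l; lra).
  destruct lengths_positive as (_ & _ & H3 & H4 & _).
  rewrite IH by lra. rewrite shift_first by (unfold u in *; lra). ring.
Qed.

Lemma shift_pow_last n s : 0 <= s <= l * u -> shift_pow n (b - s) = b - s / l ^ n.
Proof.
  intros Hs. induction n as [|n IH]; cbn; [field|].
  assert (Hp : 1 <= l ^ n) by (apply pow_R1_Rle; lra).
  assert (E : l ^ n * (s / l ^ n) = s) by (field; lra).
  assert (H0 : 0 <= s / l ^ n) by (apply Rmult_le_reg_l with (l ^ n); lra).
  assert (H1 : s / l ^ n <= l * u) by nra.
  rewrite IH. destruct lengths_positive as (_ & _ & _ & _ & _ & H5).
  rewrite shift_last by lra. field. split; lra.
Qed.

(** One step crosses the middle piece; the other [n] contract towards [b]. *)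
Lemma shift_pow_middle n t : e + u <= t <= e + l * u ->
  shift_pow (S n) t = b - ((l + 1) * u - (t - e)) / l ^ n.
Proof.
  intros H. replace (S n) with (n + 1)%nat by lia. rewrite shift_pow_add.
  change (shift_pow 1 t) with (shift t). rewrite shift_middle_last by assumption.
  apply shift_pow_last. destruct lengths_positive as (_ & _ & H3 & _). lra.
Qed.

Lemma generators_inF (Lam A : R -> Prop) :
  admissible r Lam A -> Lam l -> A e ->
  inF r Lam A shift /\ inF r Lam A squeeze /\ inF r Lam A half_shift.
Proof.
  intros Hadm Ll Ae.
  pose proof Hadm as (_ & _ & L1 & _ & Linv & _ & Aadd & Aopp & Ar & Amul).
  assert (Asub : forall x y, A x -> A y -> A (x - y)) by (intros; apply Aadd; auto).
  assert (Au : A u) by (replace u with (l * e - e) by (unfold u; ring); auto).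
  assert (Alu : A (l * u)) by auto.
  assert (Alu1 : A ((l - 1) * u)) by (replace ((l - 1) * u) with (l * u - u) by ring; auto).
  assert (Alu2 : A ((l - 2) * u))
    by (replace ((l - 2) * u) with (l * u - u - u) by ring; auto).
  assert (A2lu : A (2 * l * u)) by (replace (2 * l * u) with (l * u + l * u) by ring; auto).
  assert (A3 : A ((2 * l - 3) * e))
    by (replace ((2 * l - 3) * e) with (l * e + l * e - e - e - e) by ring; auto 10).
  assert (A4 : A ((2 * l * l - 2) * e))
    by (replace ((2 * l * l - 2) * e) with (l * (l * e) + l * (l * e) - e - e) by ring;
        auto 10).
  assert (Ab : A b) by (unfold b; auto).
  assert (Linvl : Lam (/ l)) by auto.
  assert (Hinv : 0 < / l) by (apply Rinv_0_lt_compat; lra).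
  destruct scale_facts as (F1 & F2 & F3 & F4 & F5).
  destruct lengths_positive as (H1 & H2 & H3 & H4 & _).
  split; [|split]; apply pl_map_inF; try exact Hadm;
    try solve [repeat (apply Forall_cons; [split; cbn [fst snd]; auto|]);
               apply Forall_nil];
    try solve [repeat (apply Forall_cons; [split; cbn [fst snd];
                 try lra; unfold r; nra|]); apply Forall_nil];
    cbn; unfold r, b, u in *; lra.
Qed.

(** * Maps commuting with [shift] *)

Section Centralizer.
Variable h : R -> R.
Hypothesis h_commutes : forall t, h (shift t) = shift (h t).
Hypothesis h_injective : forall s t, h s = h t -> s = t.

Lemma h_shift_pow n t : h (shift_pow n t) = shift_pow n (h t).
Proof. induction n; cbn; [reflexivity|]. now rewrite h_commutes, IHn. Qed.

Lemma h_moves t : e < t < b -> e < h t < b.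
Proof.
  rewrite <- !shift_moves. intros H E. apply H, h_injective. now rewrite h_commutes.
Qed.

(** As [shift] fixes [e], the point [h e] lies outside [(e, b)], while points just to the right of
    [e] are sent into [(e, b)]; only [h e = e] fits both. *)
Lemma h_fixes_left_end eps mu : 0 < eps -> 0 < mu ->
  (forall s, 0 <= s < eps -> h (e + s) = h e + mu * s) -> h e = e.
Proof.
  intros Heps Hmu Hh. destruct lengths_positive as (H1 & _).
  assert (Hout : ~ e < h e < b).
  { rewrite <- shift_moves. intros H. apply H. rewrite <- h_commutes.
    now rewrite shift_fixed by lra. }
  assert (Hs : forall s, 0 < s < eps -> s < b - e -> e < h e + mu * s < b).
  { intros s Hs Hs'. rewrite <- Hh by lra. apply h_moves. lra. }
  destruct (Rlt_le_dec (h e) e) as [Hlt|Hge].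
  (* The last bound forces [h e + mu * s <= e], outside the interval. *)
  - set (s := Rmin (Rmin (eps / 2) ((b - e) / 2)) ((e - h e) / mu)).
    assert (Hs1 : s <= eps / 2) by (eapply Rle_trans; apply Rmin_l).
    assert (Hs2 : s <= (b - e) / 2)
      by (eapply Rle_trans; [apply Rmin_l|apply Rmin_r]).
    assert (Hs3 : s <= (e - h e) / mu) by apply Rmin_r.
    assert (Hpos : 0 < s).
    { repeat apply Rmin_glb_lt; try lra. apply Rdiv_lt_0_compat; lra. }
    destruct (Hs s) as [H _]; [lra|lra|].
    assert (mu * s <= mu * ((e - h e) / mu)) by (apply Rmult_le_compat_l; lra).
    replace (mu * ((e - h e) / mu)) with (e - h e) in * by (field; lra). lra.
  - set (s := Rmin (eps / 2) ((b - e) / 2)).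
    assert (Hs1 : s <= eps / 2) by apply Rmin_l.
    assert (Hs2 : s <= (b - e) / 2) by apply Rmin_r.
    assert (Hpos : 0 < s) by (apply Rmin_glb_lt; lra).
    destruct (Hs s) as [_ H]; [lra|lra|].
    assert (0 < mu * s) by nra. lra.
Qed.

Lemma pow_scale n : 0 < l ^ n.
Proof. apply pow_lt. lra. Qed.

(* Conjugation by powers of [shift] spreads the linearity of [h] near [e]. *)
Lemma h_linear eps mu s : 0 < eps -> 0 < mu ->
  (forall s, 0 <= s < eps -> h (e + s) = e + mu * s) ->
  0 <= s <= l * u -> mu * s <= l * u -> h (e + s) = e + mu * s.
Proof.
  intros Heps Hmu Hh Hs Hms.
  destruct (pow_unbounded l (l * u / eps)) as [n Hn]; [lra|].
  pose proof (pow_scale n) as Hp.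
  assert (E : l ^ n * (s / l ^ n) = s) by (field; lra).
  assert (H0 : 0 <= s / l ^ n) by (apply Rmult_le_reg_l with (l ^ n); lra).
  assert (Heps' : l * u < l ^ n * eps).
  { apply Rmult_lt_compat_r with (r := eps) in Hn; [|assumption].
    replace (l * u / eps * eps) with (l * u) in Hn by (field; lra). assumption. }
  assert (H1 : s / l ^ n < eps) by (apply Rmult_lt_reg_l with (l ^ n); lra).
  replace (e + s) with (shift_pow n (e + s / l ^ n)) by (rewrite shift_pow_first, E; lra).
  rewrite h_shift_pow, Hh by lra.
  assert (E' : l ^ n * (mu * (s / l ^ n)) = mu * s) by (field; lra).
  rewrite shift_pow_first, E'; [reflexivity|apply Rmult_le_pos; lra|lra].
Qed.

(* In the coordinates in which [shift] is linear near [e] and near [b]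
   respectively, the transition map has a single break in each fundamental domain, while [h]
   is a scaling on both sides; a slope [mu] strictly between 1 and [l] would move
   that break. *)
Lemma h_slope_one eps mu eps' nu c : 0 < eps -> 1 <= mu < l ->
  (forall s, 0 <= s < eps -> h (e + s) = e + mu * s) -> 0 < eps' ->
  (forall s, 0 < s < eps' -> h (b - s) = c - nu * s) -> mu = 1.
Proof.
  intros Heps Hmu Hh Heps' Hb.
  destruct lengths_positive as (_ & _ & Hu & Hlu & _).
  (* Evaluating [h] at [shift_pow (S m) (e + s)] from either end compares the scaling by [mu] near
     [e] with that by [nu] near [b]. *)
  assert (Hrel : forall s, u <= s <= l * u -> mu * s <= l * u ->
            nu * ((l + 1) * u - s) = (l + 1) * u - mu * s).
  { intros s Hs Hms.
    destruct (pow_unbounded l ((l + 1) * u / eps')) as [n Hn]; [lra|].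
    assert (Hn' : (l + 1) * u < l ^ n * eps').
    { apply Rmult_lt_compat_r with (r := eps') in Hn; [|assumption].
      replace ((l + 1) * u / eps' * eps') with ((l + 1) * u) in Hn by (field; lra).
      assumption. }
    assert (Heq : forall m, (n <= m)%nat ->
              c - b = (nu * ((l + 1) * u - s) - ((l + 1) * u - mu * s)) / l ^ m).
    { intros m Hm. pose proof (pow_scale m) as Hpm.
      assert (Hpow : l ^ n <= l ^ m) by (apply Rle_pow; [lra|assumption]).
      assert (E : l ^ m * (((l + 1) * u - s) / l ^ m) = (l + 1) * u - s)
        by (field; lra).
      assert (E1 := h_shift_pow (S m) (e + s)).
      rewrite (h_linear eps mu s) in E1 by (assumption || lra).
      rewrite !shift_pow_middle in E1 by nra.
      replace (e + s - e) with s in E1 by ring.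
      replace (e + mu * s - e) with (mu * s) in E1 by ring.
      rewrite Hb in E1.
      - replace c with (c - nu * (((l + 1) * u - s) / l ^ m) +
                        nu * (((l + 1) * u - s) / l ^ m)) by ring.
        rewrite E1. field. lra.
      - split.
        + apply Rmult_lt_reg_l with (l ^ m); lra.
        + apply Rmult_lt_reg_l with (l ^ m); [assumption|]. nra. }
    (* One numerator over two consecutive powers of [l] gives the same [c - b], so it vanishes. *)
    assert (E0 := Heq n (le_n n)). assert (E1 := Heq (S n) (le_S n n (le_n n))).
    set (D := nu * ((l + 1) * u - s) - ((l + 1) * u - mu * s)) in *.
    pose proof (pow_scale n) as Hpn.
    assert (E2 : D / l ^ n = l * (D / l ^ S n)) by (cbn; field; lra).
    assert (HD : D / l ^ n = 0) by nra.
    assert (HD' : D = l ^ n * (D / l ^ n)) by (field; lra).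
    rewrite HD in HD'. unfold D in HD'. lra. }
  (* An affine relation holding at two points gives [nu = mu], and then [mu = 1]; the points are
     distinct because [mu < l]. *)
  assert (R1 := Hrel u). assert (R2 := Hrel (l * u / mu)).
  assert (E : mu * (l * u / mu) = l * u) by (field; lra).
  assert (Hlt : u < l * u / mu) by (apply Rmult_lt_reg_l with mu; nra).
  assert (Hle : l * u / mu <= l * u) by nra.
  specialize (R1 ltac:(lra) ltac:(nra)). specialize (R2 ltac:(lra) ltac:(lra)).
  assert (Enu : nu = mu).
  { apply Rmult_eq_reg_r with (l * u / mu - u); lra. }
  subst nu. nra.
Qed.
End Centralizer.

(** * Numbers and relations inside the group [G] *)

Section Group.
Variable G : (R -> R) -> Prop.
Hypothesis G_subgroup : is_subgroup_of_V r G.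
Hypothesis G_shift : G shift.
Hypothesis G_squeeze : G squeeze.
Hypothesis G_half_shift : G half_shift.

Lemma G_mul f g : G f -> G g -> G (gmul f g).
Proof. apply G_subgroup. Qed.

Lemma G_inv f : G f -> G (ginv f).
Proof. apply G_subgroup. Qed.

Lemma G_conj f h : G f -> G h -> G (conj_map f h).
Proof. intros. apply G_mul; [now apply G_inv|now apply G_mul]. Qed.

Lemma G_shift_pow n : G (shift_pow n).
Proof.
  induction n as [|n IH]; [apply G_subgroup|]. exact (G_mul _ _ IH G_shift).
Qed.

Lemma G_permutation f : G f -> permutation f.
Proof.
  intros Hf. apply G_subgroup in Hf as [Hf _]. now apply (bij_r_permutation r).
Qed.

Lemma shift_pow_injective n s t : shift_pow n s = shift_pow n t -> s = t.
Proof. apply permutation_injective, G_permutation, G_shift_pow. Qed.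

Lemma shift_pow_shift n t : shift_pow n (shift t) = shift (shift_pow n t).
Proof. induction n as [|n IH]; cbn; [reflexivity|now rewrite IH]. Qed.

Lemma centralizer_normalised h eps mu :
  G h -> (forall t, h (shift t) = shift (h t)) -> 0 < eps -> 1 <= mu < l ->
  (forall s, 0 <= s < eps -> h (e + s) = e + mu * s) ->
  forall t, e <= t <= e + l * u -> h t = t.
Proof.
  intros Hh Hc Heps Hmu Hg t Ht.
  destruct lengths_positive as (H1 & H2 & _).
  destruct (left_germ r posR allR h b) as (eps' & nu & c & Heps' & Hb);
    [apply (proj1 G_subgroup h Hh)|lra|].
  assert (mu = 1) as ->
    by (apply (h_slope_one h Hc eps mu eps' nu c); auto).
  replace t with (e + (t - e)) at 1 by ring.
  rewrite (h_linear h Hc eps 1); auto; lra.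
Qed.

(** Composing with a power of [shift] or its inverse brings the slope at [e] into [[1, l)]; the
    composite is then the identity up to [e + l * u]. *)
Lemma centralizer_power h : G h -> commuting h shift ->
  exists n, (forall t, e <= t <= e + l * u -> h t = shift_pow n t) \/
            (forall t, e <= t <= e + l * u -> shift_pow n (h t) = t).
Proof.
  intros Hh Hc. rewrite commuting_iff in Hc.
  assert (Hc' : forall t, h (shift t) = shift (h t)) by (intros; symmetry; apply Hc).
  assert (Hinj : forall s t, h s = h t -> s = t)
    by (intros s t; apply permutation_injective, G_permutation, Hh).
  destruct lengths_positive as (H1 & H2 & H3 & H4 & _).
  destruct (right_germ r posR allR h e) as (eps & mu & Heps & Hmu & Hg);
    [apply (proj1 G_subgroup h Hh)|unfold in_r; lra|].
  unfold posR in Hmu.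
  rewrite (h_fixes_left_end h Hc' Hinj eps mu) in Hg by assumption.
  destruct (slope_normalisation l mu) as (n & Hn); [lra|assumption|].
  exists n. pose proof (pow_scale n) as Hp.
  destruct Hn as [Hn|Hn]; [left|right].
  - set (h' := gmul h (ginv (shift_pow n))).
    assert (Hh' : forall t, shift_pow n (h' t) = h t)
      by (intros t; apply (G_permutation _ (G_shift_pow n))).
    enough (Hid : forall t, e <= t <= e + l * u -> h' t = t)
      by (intros t Ht; now rewrite <- Hh', Hid).
    (* The second bound on the radius keeps [mu * s] within the range of [shift_pow_first]. *)
    apply (centralizer_normalised h' (Rmin eps (l * u / mu)) (mu / l ^ n)); auto.
    + apply G_mul; [assumption|]. apply G_inv, G_shift_pow.
    + intros t. apply (shift_pow_injective n). now rewrite Hh', shift_pow_shift, Hh'.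
    + apply Rmin_glb_lt; [assumption|]. apply Rdiv_lt_0_compat; lra.
    + intros s [Hs0 Hs].
      pose proof (Rmin_l eps (l * u / mu)). pose proof (Rmin_r eps (l * u / mu)).
      assert (E : l ^ n * (mu / l ^ n * s) = mu * s) by (field; lra).
      assert (Hms : mu * s < l * u).
      { replace (l * u) with (mu * (l * u / mu)) by (field; lra).
        apply Rmult_lt_compat_l; lra. }
      apply (shift_pow_injective n). rewrite Hh', Hg by lra.
      rewrite shift_pow_first; rewrite ?E; [reflexivity| |lra].
      apply Rmult_le_pos; lra.
  - apply (centralizer_normalised (gmul h (shift_pow n))
             (Rmin eps (l * u / (mu * l ^ n))) (mu * l ^ n)); auto.
    + apply G_mul; [assumption|apply G_shift_pow].
    + intros t. unfold gmul. now rewrite Hc', shift_pow_shift.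
    + apply Rmin_glb_lt; [assumption|]. apply Rdiv_lt_0_compat; nra.
    + intros s [Hs0 Hs]. set (k := mu * l ^ n) in *.
      pose proof (Rmin_l eps (l * u / k)). pose proof (Rmin_r eps (l * u / k)).
      assert (Hms : k * s < l * u).
      { replace (l * u) with (k * (l * u / k)) by (field; lra).
        apply Rmult_lt_compat_l; lra. }
      unfold gmul. rewrite Hg by lra.
      replace (k * s) with (l ^ n * (mu * s)) in * by (unfold k; ring).
      apply shift_pow_first; [apply Rmult_le_pos; lra|lra].
Qed.

Definition origin : R -> R := conj_map shift squeeze.
Notation number := (num (R -> R) gmul ginv shift squeeze).
Notation core t := (l * e < t < (3 * l - 2) * e).

Lemma origin_moves t : origin t <> t <-> core t.
Proof.
  unfold origin. rewrite conj_map_moves by (now apply G_permutation). split.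
  - intros (q & Hq & ->). apply shift_moves in Hq. now apply squeeze_range.
  - intros Ht. destruct (squeeze_onto t Ht) as (q & Hq & <-). exists q.
    now rewrite shift_moves.
Qed.

Lemma number_conj n : number n = conj_map origin (shift_pow n).
Proof.
  apply conj_map_unique; [apply G_permutation, G_shift_pow|].
  intros q. induction n as [|n IH]; [reflexivity|].
  cbn [num shift_pow]. fold conj_map.
  rewrite conj_map_apply by (now apply G_permutation). now rewrite IH.
Qed.

Lemma G_number n : G (number n).
Proof.
  rewrite number_conj. unfold origin. auto using G_conj, G_shift_pow.
Qed.

Lemma core_bounds t : core t -> l * e <= t < e + l * u /\ e < t < b.
Proof.
  intros H. pose proof lengths_positive. unfold b, u in *. split; nra.
Qed.

(** Common shifts cancel until one exponent is zero, and a positive power leaves the fundamental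
    domain. *)
Lemma shift_pow_disjoint n m s t :
  l * e <= s < e + l * u -> l * e <= t < e + l * u ->
  shift_pow n s = shift_pow m t -> n = m.
Proof.
  revert m. induction n as [|n IH]; intros [|m] Hs Ht E.
  - reflexivity.
  - pose proof (shift_pow_jump m t). cbn [shift_pow] in *. lra.
  - pose proof (shift_pow_jump n s). cbn [shift_pow] in *. lra.
  - f_equal. apply IH; auto. apply (shift_pow_injective 1). exact E.
Qed.

Lemma number_moves n t : number n t <> t <-> exists q, core q /\ t = shift_pow n q.
Proof.
  rewrite number_conj, conj_map_moves by apply G_permutation, G_shift_pow.
  split; intros (q & Hq & E); exists q; split; auto; now apply origin_moves.
Qed.

(** A test point of the core, far enough to the right for [half_shift] to agree with [shift]. *)
Let t0 := (3 * l - 3) * e.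

Lemma core_t0 : core t0.
Proof. unfold t0. split; nra. Qed.

Lemma number_injective n m : number n = number m -> n = m.
Proof.
  intros E. assert (H : number n (shift_pow n t0) <> shift_pow n t0)
    by (apply number_moves; exists t0; auto using core_t0).
  rewrite E in H. apply number_moves in H as (q & Hq & E').
  apply shift_pow_disjoint with (s := t0) (t := q); auto;
    apply core_bounds; auto using core_t0.
Qed.

(* [half_shift] maps a point moved by a number to one moved by its successor. *)
Lemma half_shift_number n : ~ commuting half_shift (number n).
Proof.
  rewrite commuting_iff. intros H.
  assert (Ht : forall m, half_shift (shift_pow m t0) = shift_pow (S m) t0).
  { intros m. cbn [shift_pow]. apply half_shift_eq_shift. pose proof (shift_pow_ge m t0).
    unfold t0 in *. nra. }
  specialize (H (shift_pow n t0)). rewrite Ht in H.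
  destruct (classic (number n (shift_pow (S n) t0) = shift_pow (S n) t0)) as [E|E].
  - rewrite E, <- Ht in H.
    assert (Hn : number n (shift_pow n t0) <> shift_pow n t0)
      by (apply number_moves; exists t0; auto using core_t0).
    apply Hn, (permutation_injective half_shift); [now apply G_permutation|now symmetry].
  - apply number_moves in E as (q & Hq & E).
    apply shift_pow_disjoint in E; [lia|apply core_bounds, core_t0|now apply core_bounds].
Qed.

Lemma shift_commutes_shift_pow n : commuting (shift_pow n) shift.
Proof. apply commuting_iff. intros t. symmetry. apply shift_pow_shift. Qed.

(** An inverse power would push the support of [origin] below [l * e], where [half_shift] is the
    identity, and so make the two commute. *)
Lemma number_centralizer h :
  G h -> commuting h shift -> ~ commuting half_shift (conj_map origin h) ->
  exists n, forall t, e <= t <= e + l * u -> h t = shift_pow n t.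
Proof.
  intros Hh Hc HP. destruct (centralizer_power h Hh Hc) as (n & [H|H]); [now exists n|].
  exists 0%nat. destruct n as [|n]; [exact H|]. exfalso. apply HP.
  apply disjoint_commuting; [now apply G_permutation| |].
  { apply G_permutation. unfold origin. auto using G_conj. }
  intros t Ht1 Ht2. apply half_shift_moves in Ht1 as [Ht1 _].
  apply conj_map_moves in Ht2 as (q & Hq & ->); [|now apply G_permutation].
  apply origin_moves, core_bounds in Hq as [Hq1 Hq2].
  pose proof (shift_pow_jump n (h q)) as Hj. rewrite H in Hj; lra.
Qed.

Lemma conj_power f h n :
  G f -> G h -> (forall t, e <= t <= e + l * u -> h t = shift_pow n t) ->
  (forall t, f t <> t -> core t) -> conj_map f h = conj_map f (shift_pow n).
Proof.
  intros Hf Hh Hn Hcore. apply conj_map_agree; auto using G_permutation, G_shift_pow.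
  intros q Hq. apply Hn. apply Hcore, core_bounds in Hq. lra.
Qed.

Lemma is_num_number y :
  is_num (R -> R) G gmul ginv shift squeeze half_shift y <-> exists n, y = number n.
Proof.
  split.
  - intros (h & Hh & Hc & -> & HP).
    destruct (number_centralizer h Hh Hc HP) as (n & Hn). exists n.
    rewrite number_conj. apply conj_power; auto.
    + now apply G_conj.
    + intros t. apply origin_moves.
  - intros (n & ->). exists (shift_pow n). split; [apply G_shift_pow|].
    split; [apply shift_commutes_shift_pow|].
    split; [apply number_conj|apply half_shift_number].
Qed.

(** The place of the pair [(n, m)]: [origin] put there tests membership, [probe] put there changes
    it. *)
Definition cell (n m : nat) (f : R -> R) : R -> R :=
  conj_map (conj_map (conj_map f (shift_pow m)) squeeze) (shift_pow n).

Lemma cell_moves n m f t : cell n m f t <> t ->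
  exists q, f q <> q /\ t = shift_pow n (squeeze (shift_pow m q)).
Proof.
  intros H. apply conj_map_moves in H as (q1 & H & ->);
    [|apply G_permutation, G_shift_pow].
  apply conj_map_moves in H as (q2 & H & ->); [|now apply G_permutation].
  apply conj_map_moves in H as (q & H & ->); [|apply G_permutation, G_shift_pow].
  now exists q.
Qed.

Lemma G_cell n m f : G f -> G (cell n m f).
Proof. intros. unfold cell. auto using G_conj, G_shift_pow. Qed.

Lemma shift_pow_support n t : e < t < b -> e < shift_pow n t < b.
Proof.
  induction n as [|n IH]; cbn; [auto|]. intros H. apply IH in H.
  rewrite <- shift_moves in *. intros E. apply H.
  apply (permutation_injective shift) in E; auto using G_permutation.
Qed.

(** Any witness agrees with some power of [shift] on the fundamental domain; injectivity of the
    numbers makes the exponent [n], and squeezed supports lie in the core. *)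
Lemma related_number g n m :
  related (R -> R) G gmul ginv shift squeeze g (number n) (number m) <->
  ~ commuting g (cell n m origin).
Proof.
  assert (Hnum : conj_map (number m) squeeze =
            conj_map (conj_map origin (shift_pow m)) squeeze)
    by now rewrite number_conj.
  split.
  - intros (h & Hh & Hc & E & Hg).
    destruct (number_centralizer h Hh Hc) as (n' & Hn').
    { change (number n = conj_map origin h) in E. rewrite <- E. apply half_shift_number. }
    assert (n' = n) as ->.
    { apply number_injective. change (number n = conj_map origin h) in E.
      rewrite E, number_conj. symmetry. apply conj_power; auto.
      - now apply G_conj.
      - intros t. apply origin_moves. }
    unfold cell. rewrite <- Hnum, <- (conj_power _ h n); auto.
    + apply G_conj; [apply G_number|assumption].
    + intros t Ht. apply conj_map_moves in Ht as (q & Hq & ->);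
        [|now apply G_permutation].
      apply number_moves in Hq as (q' & Hq' & ->).
      apply squeeze_range, shift_pow_support, core_bounds, Hq'.
  - intros Hg. exists (shift_pow n). split; [apply G_shift_pow|].
    split; [apply shift_commutes_shift_pow|].
    split; [apply number_conj|]. unfold cell in Hg. now rewrite <- Hnum in Hg.
Qed.

(** Conjugating by [squeeze] reduces its failure to commute with [origin] to that of [half_shift]
    with [shift]. *)
Definition probe : R -> R := conj_map half_shift squeeze.

Lemma probe_core t : probe t <> t -> core t.
Proof.
  intros H. apply conj_map_moves in H as (q & Hq & ->); [|now apply G_permutation].
  apply half_shift_moves in Hq. apply squeeze_range. nra.
Qed.

Lemma probe_origin : ~ commuting probe origin.
Proof.
  intros H. apply conj_map_commuting in H; [|now apply G_permutation].
  (* [half_shift] fixes [l * e] but moves its image [e + l * u] under [shift]. *)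
  rewrite commuting_iff in H. specialize (H (l * e)).
  destruct lengths_positive as (H1 & H2 & H3 & H4 & _ & H5).
  rewrite (half_shift_fixed (l * e)) in H by lra.
  rewrite shift_middle in H by (unfold u in *; nra).
  replace (l * e + (l - 1) * u) with (e + l * u) in H by (unfold u; ring).
  rewrite half_shift_eq_shift in H by (pose proof scale_facts; unfold u; lra).
  symmetry in H. revert H. apply shift_moves. lra.
Qed.

(** A common point of the supports determines the outer exponent and, once [squeeze] is undone, the
    inner one. *)
Lemma cell_commuting n m n' m' :
  (n, m) <> (n', m') -> commuting (cell n m probe) (cell n' m' origin).
Proof.
  intros Hne. assert (GV : G probe) by now apply G_conj.
  assert (GW : G origin) by now apply G_conj.
  apply disjoint_commuting; try (apply G_permutation; now apply G_cell).
  intros t H1 H2. apply cell_moves in H1 as (q1 & H1 & ->).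
  apply cell_moves in H2 as (q2 & H2 & E).
  apply probe_core, core_bounds in H1 as [H1 H1'].
  apply origin_moves, core_bounds in H2 as [H2 H2'].
  assert (n = n') as ->.
  { apply shift_pow_disjoint with (3 := E);
      apply core_bounds, squeeze_range, shift_pow_support; assumption. }
  apply shift_pow_injective, (permutation_injective squeeze) in E;
    [|now apply G_permutation].
  apply Hne. f_equal. now apply (shift_pow_disjoint m m' q1 q2).
Qed.

Theorem group_arithmetic : arithmetic (R -> R) G gmul ginv shift squeeze half_shift.
Proof.
  assert (Hnum : forall n, is_num (R -> R) G gmul ginv shift squeeze half_shift (number n))
    by (intros n; apply is_num_number; now exists n).
  assert (GV : G probe) by now apply G_conj.
  split; [apply (Hnum 0%nat)|].
  split.
  { intros y (n & ->)%is_num_number. apply (Hnum (S n)). }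
  split.
  { intros y (n & ->)%is_num_number y' (m & ->)%is_num_number E.
    apply (number_injective (S n) (S m)) in E. congruence. }
  split.
  { intros y (n & ->)%is_num_number E.
    apply (number_injective (S n) 0) in E. discriminate. }
  split.
  (* The identity commutes with everything and encodes the empty relation. *)
  { exists gone. split; [apply G_subgroup|].
    intros i (n & ->)%is_num_number j (m & ->)%is_num_number H.
    apply related_number in H. apply H. reflexivity. }
  intros g Hg i (n & ->)%is_num_number j (m & ->)%is_num_number.
  assert (Heq : forall n' m', number n' = number n /\ number m' = number m <->
            (n, m) = (n', m')).
  { intros n' m'. split; [|intros [= -> ->]; auto].
    intros [->%number_injective ->%number_injective]. reflexivity. }
  (* If the pair is absent, a [probe] in its cell inserts it and disturbs no other cell; if it is
     present, [g] itself serves. *)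
  destruct (classic (commuting g (cell n m origin))) as [Hc|Hc].
  - exists (gmul g (cell n m probe)).
    split; [apply G_mul; [assumption|now apply G_cell]|].
    intros i' (n' & ->)%is_num_number j' (m' & ->)%is_num_number.
    rewrite !related_number, Heq.
    destruct (classic ((n, m) = (n', m'))) as [[= <- <-]|Hne].
    + split; [auto|]. intros _ H.
      apply commuting_mul_left in H; [|now apply G_permutation|assumption].
      apply probe_origin. unfold cell in H.
      apply conj_map_commuting in H; [|apply G_permutation, G_shift_pow].
      apply conj_map_commuting in H; [|now apply G_permutation].
      apply conj_map_commuting in H; [assumption|apply G_permutation, G_shift_pow].
    + rewrite commuting_mul_right;
        [tauto|apply G_permutation; now apply G_cell|now apply cell_commuting].
  - exists g. split; [assumption|].
    intros i' (n' & ->)%is_num_number j' (m' & ->)%is_num_number.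
    rewrite !related_number, Heq. split; [auto|].
    intros [H|[= <- <-]]; assumption.
Qed.
End Group.
End Generators.

(** A nontrivial element or its inverse exceeds 1, and its powers are unbounded. *)
Lemma large_slope (Lam : R -> Prop) :
  (forall l, Lam l -> 0 < l) -> Lam 1 ->
  (forall l m, Lam l -> Lam m -> Lam (l * m)) -> (forall l, Lam l -> Lam (/ l)) ->
  (exists l, Lam l /\ l <> 1) -> exists l, Lam l /\ 4 <= l.
Proof.
  intros Hpos H1 Hmul Hinv (l & Hl & Hne).
  assert (Hex : exists k, Lam k /\ 1 < k).
  { pose proof (Hpos l Hl). destruct (Rlt_le_dec 1 l) as [Hlt|Hle]; [now exists l|].
    exists (/ l). split; [auto|]. apply Rmult_lt_reg_l with l; [assumption|].
    rewrite Rinv_r; lra. }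
  destruct Hex as (k & Hk & Hk1). destruct (pow_unbounded k 4 Hk1) as [n Hn].
  exists (k ^ n). split; [|lra]. clear Hn. induction n; cbn; auto.
Qed.

Theorem theoremC (r : R) (Lam A : R -> Prop) (G : (R -> R) -> Prop) :
  admissible r Lam A ->
  (exists l, Lam l /\ l <> 1) ->
  is_subgroup_of_V r G ->
  (forall x, (G x /\ inF r posR allR x) <-> inF r Lam A x) ->
  hereditarily_undecidable (elem_theory G).
Proof.
  intros Hadm Hne HG HF.
  pose proof Hadm as (Hr & Hpos & H1 & Hmul & Hinv & _ & _ & _ & Ar & Amul).
  destruct (large_slope Lam) as (l & Ll & Hl); auto.
  (* The scale is chosen so that [r = l * l * l * e], and it lies in [A] because [r] does and [/ l]
     lies in [Lam]. *)
  set (e := / l * (/ l * (/ l * r))).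
  assert (Hinv' : 0 < / l) by (apply Rinv_0_lt_compat; lra).
  assert (He : 0 < e) by (unfold e; repeat apply Rmult_lt_0_compat; assumption).
  assert (Ae : A e) by (unfold e; auto).
  assert (Er : r = l * l * l * e) by (unfold e; field; lra).
  clearbody e. subst r.
  destruct (generators_inF l e Hl He Lam A Hadm Ll Ae) as (FX & FZ & FP).
  apply HF in FX as [GX _], FZ as [GZ _], FP as [GP _].
  apply (arithmetic_hereditarily_undecidable (R -> R) G gmul ginv gone
           (fun _ => gone) (shift l e) (squeeze l e) (half_shift l e)); auto.
  - apply HG.
  - apply HG.
  - now apply group_arithmetic.
Qed.
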